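(* Let $\Omega\subset\mathbb{R}^d$ ($d\ge 2$) be a bounded connected open polygonal set, let $\boldsymbol v\in L^p(\Omega)^d$ with $2<p<+\infty$ if $d=2$ and $p=d$ if $d\ge3$, let $\lambda:\mathbb{R}\to\mathbb{R}$ be a continuous function such that $\lambda_\infty\ge\lambda(r)\ge\mu>0$ for all $r\in\mathbb{R}$, with $\lambda_\infty$ and $\mu$ two real numbers, and let $f\in L^1(\Omega)$ satisfy $\int_\Omega f\,dx=0$. Let $\mathcal M$ be an admissible mesh of $\Omega$ satisfying the regularity condition: there exists $\xi>0$ such that $d(x_K,\sigma)\ge\xi d_\sigma$ for all $K\in\mathcal T$ and all $\sigma\in\mathcal E_K$. Then there exists a solution $u_{\mathcal T}=(u_K)_{K\in\mathcal T}\in X(\mathcal T)$, having $\underline{\mathrm{med}}(u_{\mathcal T})=0$, of the finite volume scheme $$\forall K\in\mathcal T,\quad \sum_{\sigma\in\mathcal E_{int}(K)}\frac{\mathrm m(\sigma)}{d_\sigma}\lambda(u)_\sigma(u_K-u_L)+\sum_{\sigma\in\mathcal E_{int}(K)}\mathrm m(\sigma)\,\boldsymbol v_{K,\sigma}\,u_{\sigma,+}=\int_K f\,dx,$$ where in the sums $\sigma=K|L$, and where for all $\sigma=K|L\in\mathcal E_{int}$: $u_{\sigma,+}=u_K$ if $\boldsymbol v_{K,\sigma}\ge0$ and $u_{\sigma,+}=u_L$ otherwise; and $$\min[\lambda(u_K),\lambda(u_L)]\le\lambda(u)_\sigma\le\max[\lambda(u_K),\lambda(u_L)]$$ (where $\lambda(u)_\sigma$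 is for example the mean value of $\lambda(u_K)$ and $\lambda(u_L)$).
   Context: Admissible mesh: an admissible mesh $\mathcal M$ of $\Omega$ is given by a finite family $\mathcal T$ of disjoint open convex polygonal subsets of $\Omega$ (control volumes), a finite family $\mathcal E$ of disjoint subsets of $\overline\Omega$ (edges) which are non-empty open convex subsets of affine hyperplanes, and a family of points $(x_K)_{K\in\mathcal T}$ in $\Omega$ such that: $\overline\Omega=\bigcup_{K\in\mathcal T}\overline K$; each $\sigma\in\mathcal E$ is a non-empty open subset of $\partial K$ for some $K\in\mathcal T$; with $\mathcal E_K=\{\sigma\in\mathcal E:\sigma\subset\partial K\}$, $\partial K=\bigcup_{\sigma\in\mathcal E_K}\overline\sigma$ for all $K\in\mathcal T$; for all $K\ne L$ in $\mathcal T$, either the $(d-1)$-dimensional measure of $\overline K\cap\overline L$ is zero or $\overline K\cap\overline L=\overline\sigma$ for some $\sigma\in\mathcal E$, which is then denoted $\sigma=K|L$; $x_K\in K$ for all $K\in\mathcal T$; for all $\sigma=K|L\in\mathcal E$, the straight line $(x_K,x_L)$ intersects and is orthogonal to $\sigma$; for all $\sigma\in\mathcal E$ with $\sigma\subset\partial\Omega\cap\partial K$, the line which is orthogonal to $\sigma$ and goes through $x_K$ intersects $\sigma$. Notation: $\mathcal E_{int}$ and $\mathcal E_{ext}$ are the sets of interior and boundary edges; $\mathcal E_{int}(K)=\mathcal E_K\cap\mathcal E_{int}$; $\mathrm m(K)$ and $\mathrm m(\sigma)$ are the $d$- and $(d-1)$-dimensional measures; $\mathbf n_{K,\sigma}$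 is the unit normal to $\sigma\in\mathcal E_K$ outward to $K$; $d_{K,\sigma}=d(x_K,\sigma)$ is the Euclidean distance; $d_\sigma=|x_K-x_L|=d_{K,\sigma}+d_{L,\sigma}$ if $\sigma=K|L\in\mathcal E_{int}$, and $d_\sigma=d_{K,\sigma}$ if $\sigma\in\mathcal E_{ext}\cap\mathcal E_K$. $X(\mathcal T)$ is the set of functions $\Omega\to\mathbb{R}$ constant on each control volume, written $u=(u_K)_{K\in\mathcal T}$. $D_{K,\sigma}$ is the cone with basis $\sigma$ and vertex $x_K$; $D_\sigma=D_{K,\sigma}\cup D_{L,\sigma}$ if $\sigma=K|L\in\mathcal E_{int}$ and $D_\sigma=D_{K,\sigma}$ if $\sigma\in\mathcal E_{ext}\cap\mathcal E_K$; $\mathrm m(D_\sigma)=\frac1d d_\sigma\mathrm m(\sigma)$. $\boldsymbol v_{K,\sigma}=\frac1{\mathrm m(D_\sigma)}\int_{D_\sigma}\boldsymbol v\cdot\mathbf n_{K,\sigma}\,dx$. $\underline{\mathrm{med}}(u)=\inf\{t\in\mathbb{R}:\mathrm{meas}\{x\in\Omega:u(x)>t\}\le\mathrm{meas}(\Omega)/2\}$.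
   Formalization: The choice of λ(u)_σ between the min and max of λ(u_K), λ(u_L) is a given rule assumed to depend continuously on u (as the mean value does); for a discontinuous rule the scheme may have no solution. *)

(* Defs.v *)
From HB Require Import structures.
From mathcomp Require Import all_boot all_order all_algebra.
From mathcomp Require Import all_classical all_reals all_analysis.

Set Implicit Arguments.
Unset Strict Implicit.
Unset Printing Implicit Defensive.

Import Order.TTheory GRing.Theory Num.Theory.
Import numFieldNormedType.Exports.

Local Open Scope classical_set_scope.
Local Open Scope ring_scope.

Section LebesgueTuple.
Local Open Scope ereal_scope.
Variable R : realType.
Notation Rm := (measurableTypeR R).

Definition tcons n (p : Rm * n.-tuple Rm) : n.+1.-tuple Rm :=
  [tuple of p.1 :: p.2].

Lemma measurable_tcons n : measurable_fun setT (@tcons n).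
Proof. exact: measurable_cons. Qed.

Section step.
Variables (n : nat) (mu : {sigma_finite_measure set (n.-tuple Rm) -> \bar R}).

Definition lebesgue_cons : set (n.+1.-tuple Rm) -> \bar R :=
  pushforward (@lebesgue_measure R \x mu) (@tcons n).

Let lebesgue_cons0 : lebesgue_cons set0 = 0.
Proof. by rewrite /lebesgue_cons /pushforward preimage_set0 measure0. Qed.

Let lebesgue_cons_ge0 A : 0 <= lebesgue_cons A.
Proof. by rewrite /lebesgue_cons /pushforward; exact: measure_ge0. Qed.

Let lebesgue_cons_sigma_additive : semi_sigma_additive lebesgue_cons.
Proof.
move=> F mF tF mUF; rewrite /lebesgue_cons /pushforward preimage_bigcup.
have mp A : measurable A -> measurable (@tcons n @^-1` A).
  by move=> mA; rewrite -[X in measurable X]setTI; exact: measurable_tcons.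
apply: measure_semi_sigma_additive.
- by move=> k; exact: mp.
- apply/trivIsetP => /= i j _ _ ij; rewrite -preimage_setI.
  by move/trivIsetP : tF => /(_ _ _ _ _ ij) ->//; rewrite preimage_set0.
- by rewrite -preimage_bigcup; exact: mp.
Qed.

HB.instance Definition _ := isMeasure.Build _ _ _ lebesgue_cons
  lebesgue_cons0 lebesgue_cons_ge0 lebesgue_cons_sigma_additive.

Let lebesgue_cons_sigma_finite : sigma_finite setT lebesgue_cons.
Proof.
have /sigma_finiteP[F [FT Fnd Foo]] := sigma_finiteT (@lebesgue_measure R).
have /sigma_finiteP[G [GT Gnd Goo]] := sigma_finiteT mu.
pose tl (t : n.+1.-tuple Rm) : n.-tuple Rm := [tuple of behead t].
pose H k : set (n.+1.-tuple Rm) := (@thead n Rm @^-1` F k) `&` (tl @^-1` G k).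
exists H.
  apply/esym/seteqP; split => // t _.
  have [i _ Fi] : (\bigcup_i F i) (thead t) by rewrite -FT.
  have [j _ Gj] : (\bigcup_i G i) (tl t) by rewrite -GT.
  exists (maxn i j) => //; split => /=.
  - by move/subsetPset: (Fnd _ _ (leq_maxl i j)); exact.
  - by move/subsetPset: (Gnd _ _ (leq_maxr i j)); exact.
move=> k; have [mF Fk] := Foo k; have [mG Gk] := Goo k; split.
  apply: measurableI.
    by rewrite -[X in measurable X]setTI; apply: measurable_tnth.
  by rewrite -[X in measurable X]setTI; apply: measurable_behead.
rewrite /lebesgue_cons /pushforward.
have -> : @tcons n @^-1` H k = F k `*` G k.
  apply/seteqP; split => -[x t]; rewrite /H /= theadE => -[Fx Gt]; split => //=.
    by move: Gt; congr (G k _); apply: val_inj.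
  by move: Gt; congr (G k _); apply: val_inj.
by rewrite /= product_measure1E// lte_mul_pinfty// ge0_fin_numE.
Qed.

HB.instance Definition _ := Measure_isSigmaFinite.Build _ _ _ lebesgue_cons
  lebesgue_cons_sigma_finite.

End step.

(* The n-fold product of the one-dimensional Lebesgue measure. *)
Fixpoint lebesgue_tuple n : {sigma_finite_measure set (n.-tuple Rm) -> \bar R} :=
  match n return {sigma_finite_measure set (n.-tuple Rm) -> \bar R} with
  | 0%N => @dirac _ (0.-tuple Rm) [tuple] R
  | k.+1 => lebesgue_cons (lebesgue_tuple k)
  end.

(* The cylinders generate the Borel sigma-algebra of R^n. *)
Definition cylinders n : set (set 'rV[R]_n) :=
  [set A : set 'rV[R]_n | exists (i : 'I_n) (B : set Rm),
     measurable B /\ A = [set x : 'rV[R]_n | B (x ord0 i)]].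

Section rV.
Variable n : nat.
Notation borel_rV := (g_sigma_algebraType (@cylinders n)).

Definition rV_of_tuple (t : n.-tuple Rm) : borel_rV := \row_i tnth t i.

Lemma measurable_rV_of_tuple : measurable_fun setT rV_of_tuple.
Proof.
apply: (@measurability _ _ (n.-tuple Rm)
  (g_sigma_algebraType (@cylinders n)) setT rV_of_tuple (@cylinders n)) => //.
move=> _ [_ [i [B [mB ->]]] <-]; rewrite setTI.
have -> : rV_of_tuple @^-1` [set x : 'rV[R]_n | B (x ord0 i)] = (@tnth n Rm ^~ i) @^-1` B.
  by apply/seteqP; split => t /=; rewrite mxE.
by rewrite -[X in measurable X]setTI; apply: measurable_tnth.
Qed.

Definition borel_lebesgue_rV : set borel_rV -> \bar R :=
  pushforward (lebesgue_tuple n) rV_of_tuple.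

Let borel_lebesgue_rV0 : borel_lebesgue_rV set0 = 0.
Proof. by rewrite /borel_lebesgue_rV /pushforward preimage_set0 measure0. Qed.

Let borel_lebesgue_rV_ge0 A : 0 <= borel_lebesgue_rV A.
Proof. by rewrite /borel_lebesgue_rV /pushforward; exact: measure_ge0. Qed.

Let borel_lebesgue_rV_sigma_additive : semi_sigma_additive borel_lebesgue_rV.
Proof.
move=> F mF tF mUF; rewrite /borel_lebesgue_rV /pushforward preimage_bigcup.
have mp A : measurable A -> measurable (rV_of_tuple @^-1` A).
  by move=> mA; rewrite -[X in measurable X]setTI; exact: measurable_rV_of_tuple.
apply: measure_semi_sigma_additive.
- by move=> k; exact: mp.
- apply/trivIsetP => /= i j _ _ ij; rewrite -preimage_setI.
  by move/trivIsetP : tF => /(_ _ _ _ _ ij) ->//; rewrite preimage_set0.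
- by rewrite -preimage_bigcup; exact: mp.
Qed.

HB.instance Definition _ := isMeasure.Build _ _ _ borel_lebesgue_rV
  borel_lebesgue_rV0 borel_lebesgue_rV_ge0 borel_lebesgue_rV_sigma_additive.

End rV.

(* R^n with the Lebesgue-measurable sets; [leb n] is a complete measure. *)
Definition lebesgue_rV_type n :=
  caratheodory_type (mu_ext (@borel_lebesgue_rV n)).
HB.instance Definition _ n := Measurable.on (lebesgue_rV_type n).

Definition leb n : set (lebesgue_rV_type n) -> \bar R :=
  @completed_measure_extension _ _ _ (@borel_lebesgue_rV n).
HB.instance Definition _ n := Measure.on (@leb n).

End LebesgueTuple.

Arguments leb {R n}.

Section Euclidean.
Variables (R : realType) (n : nat).
Implicit Types (x y a : 'rV[R]_n) (A : set 'rV[R]_n).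

(* The norm of ['rV[R]_n] in the library is the sup norm; it induces the usual
   topology, but lengths and distances below are Euclidean. *)
Definition dot x y : R := \sum_i x ord0 i * y ord0 i.
Definition enorm x : R := Num.sqrt (dot x x).
Definition edist_set x A : R := inf [set enorm (x - y) | y in A].
Definition ediam A : \bar R :=
  ereal_sup ([set 0%E] `|` [set (enorm (p.1 - p.2))%:E | p in A `*` A]).

Definition frontier A := closure A `\` A°.
Definition hyperplane a (c : R) : set 'rV[R]_n := [set x | dot a x = c].
Definition orth_to a A := forall y z, A y -> A z -> dot a (y - z) = 0.

(* An open set is polygonal (polyhedral) when its boundary lies in finitely
   many affine hyperplanes. *)
Definition polygonal A := exists s : seq ('rV[R]_n * R),
  (forall h, h \in s -> h.1 != 0) /\
  frontier A `<=` [set x | exists2 h, h \in s & hyperplane h.1 h.2 x].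

(* Hausdorff measure of integer dimension [k >= 1], normalised so as to agree
   with the Lebesgue measure on k-dimensional affine subspaces. *)
Definition hausdorff_pre (k : nat) (delta : R) A : \bar R :=
  ereal_inf [set (\sum_(i <oo) (ediam (B i)) ^+ k)%E | B in
    [set B : (set 'rV[R]_n)^nat |
      (forall i, (ediam (B i) <= delta%:E)%E) /\ A `<=` \bigcup_i B i]].
End Euclidean.

Definition unit_ball_volume (R : realType) (k : nat) : R :=
  fine (leb [set x : 'rV[R]_k | enorm x <= 1]).

Definition hausdorff (R : realType) (n k : nat) (A : set 'rV[R]_n) : \bar R :=
  ((unit_ball_volume R k / 2 ^+ k)%:E *
    ereal_sup [set hausdorff_pre k delta A | delta in [set t : R | (0 < t)%R]])%E.

Record mesh (R : realType) (d : nat) := Mesh {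
  cell : finType;
  edge : finType;
  cell_set : cell -> set 'rV[R]_d;
  edge_set : edge -> set 'rV[R]_d;
  centre : cell -> 'rV[R]_d }.

Arguments cell {R d} M : rename.
Arguments edge {R d} M : rename.
Arguments cell_set {R d M} K : rename.
Arguments edge_set {R d M} s : rename.
Arguments centre {R d M} K : rename.

Section Mesh.
Variables (R : realType) (d : nat) (Omega : set 'rV[R]_d) (M : mesh R d).
Implicit Types (K L : cell M) (s : edge M) (u : cell M -> R).

(* [s = K|L] *)
Definition separates s K L :=
  K <> L /\ closure (cell_set K) `&` closure (cell_set L) = closure (edge_set s).

Definition edge_of K s := edge_set s `<=` frontier (cell_set K).

Record admissible : Prop := Admissible {
  cell_sub : forall K, cell_set K `<=` Omega;
  cell_open : forall K, open (cell_set K);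
  cell_convex : forall K, convex_set (cell_set K);
  cell_polygonal : forall K, polygonal (cell_set K);
  cell_disjoint : forall K L, K <> L -> cell_set K `&` cell_set L = set0;
  edge_sub : forall s, edge_set s `<=` closure Omega;
  edge_nonempty : forall s, edge_set s !=set0;
  edge_convex : forall s, convex_set (edge_set s);
  edge_flat : forall s, exists (a : 'rV[R]_d) (c : R) (U : set 'rV[R]_d),
    [/\ a != 0, open U & edge_set s = U `&` hyperplane a c];
  edge_disjoint : forall s t, s <> t -> edge_set s `&` edge_set t = set0;
  cell_cover : closure Omega = \bigcup_(K in [set: cell M]) closure (cell_set K);
  edge_open : forall s, exists K (U : set 'rV[R]_d),
    open U /\ edge_set s = U `&` frontier (cell_set K);
  cell_frontier : forall K,
    frontier (cell_set K) = \bigcup_(s in edge_of K) closure (edge_set s);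
  cell_interface : forall K L, K <> L ->
    hausdorff d.-1 (closure (cell_set K) `&` closure (cell_set L)) = 0%E \/
    exists s, separates s K L;
  centre_in : forall K, cell_set K (centre K);
  interface_orth : forall s K L, separates s K L ->
    (exists t : R, edge_set s (centre K + t *: (centre L - centre K))) /\
    orth_to (centre L - centre K) (edge_set s);
  boundary_orth : forall s K,
    edge_set s `<=` frontier Omega `&` frontier (cell_set K) ->
    exists (a : 'rV[R]_d) (t : R),
      [/\ a != 0, orth_to a (edge_set s) & edge_set s (centre K + t *: a)] }.

Definition edges K : {set edge M} := [set s | `[< edge_of K s >]].
(* An edge is a boundary edge when it is included in the boundary of Omega, and
   an interior edge otherwise. *)
Definition interior_edge : pred (edge M) :=
  fun s => `[< ~ (edge_set s `<=` frontier Omega) >].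
Definition interior_edges K : {set edge M} :=
  [set s in edges K | interior_edge s].

(* [neighbour K s] is the L with [s = K|L], for s an interior edge of K; the
   default value is irrelevant, as an admissible mesh provides such an L. *)
Definition neighbour K s : cell M :=
  odflt K [pick L | `[< separates s K L >]].

Definition measure_edge s : R := fine (hausdorff d.-1 (edge_set s)).

(* K is convex, hence lies on one side of each of its edges. *)
Definition normal K s : 'rV[R]_d :=
  xget 0 [set a | [/\ enorm a = 1, orth_to a (edge_set s) &
    forall x y, cell_set K x -> edge_set s y -> dot a (x - y) < 0]].

Definition d_Ksigma K s : R := edist_set (centre K) (edge_set s).

(* [d_sigma] and [D_sigma], for s an edge of K *)
Definition d_sigma K s : R :=
  if interior_edge s then enorm (centre K - centre (neighbour K s))
  else d_Ksigma K s.

Definition cone K s : set 'rV[R]_d :=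
  [set z | exists y (t : R), [/\ edge_set s y, 0 <= t, t <= 1 &
     z = centre K + t *: (y - centre K)]].

Definition diamond K s : set 'rV[R]_d :=
  if interior_edge s then cone K s `|` cone (neighbour K s) s else cone K s.

Definition v_Ksigma (v : 'rV[R]_d -> 'rV[R]_d) K s : R :=
  (fine (leb (diamond K s)))^-1 *
    \int[leb]_(x in diamond K s) dot (v x) (normal K s).

(* The function equal to [u K] on each control volume K. The values on the
   boundaries of the control volumes, a negligible set, are irrelevant. *)
Definition cell_fun u (x : 'rV[R]_d) : R :=
  \sum_K u K * \1_(cell_set K) x.

Definition upwind u (w : R) K s : R :=
  if 0 <= w then u K else u (neighbour K s).

(* [lam s] is the value of [lambda(u)_sigma]. *)
Definition scheme (v : 'rV[R]_d -> 'rV[R]_d) (f : 'rV[R]_d -> R)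
    (lam : edge M -> R) u :=
  forall K,
    \sum_(s in interior_edges K)
      measure_edge s / d_sigma K s * lam s * (u K - u (neighbour K s)) +
    \sum_(s in interior_edges K)
      measure_edge s * v_Ksigma v K s * upwind u (v_Ksigma v K s) K s =
    \int[leb]_(x in cell_set K) f x.

End Mesh.

Definition med (R : realType) (d : nat) (Omega : set 'rV[R]_d)
    (g : 'rV[R]_d -> R) : R :=
  inf [set t | (leb (Omega `&` [set x | (t < g x)%R]) <= leb Omega * (2^-1)%:E)%E].

(* Main.v *)
From HB Require Import structures.
From mathcomp Require Import all_boot all_order all_algebra.
From mathcomp Require Import all_fingroup.
From mathcomp Require Import zify ring lra.
From mathcomp Require Import all_classical all_reals all_analysis.
Require Import Defs.

Set Implicit Arguments.
Unset Strict Implicit.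
Unset Printing Implicit Defensive.

Import Order.TTheory GRing.Theory Num.Theory.
Import numFieldNormedType.Exports.

Local Open Scope classical_set_scope.
Local Open Scope ring_scope.

(** The coefficients lambda(u)_sigma are the only nonlinearity of the scheme.
    Freeze them: for a vector c of positive numbers indexed by the edges, the
    scheme becomes a linear system A(c) u = b on the cells.  The flux through
    an interior edge K|L leaves K and enters L, because the normals of the two
    cells are opposite ([normal_opp]) and so the discrete velocities are too
    ([v_Ksigma_neighbour]); hence the columns of A(c) sum to zero, while its
    off-diagonal entries are nonpositive, and negative between neighbours.
    Up to sign and transposition, such a matrix is the generator of a Markov
    chain on the graph of the mesh.  This graph is connected
    ([mesh_connected]), so A(c) has a kernel spanned by one vector w > 0 and its
    range is the hyperplane of vectors of sum zero, to which the data b, of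
    total mass the integral of f, belongs.  The solutions are the x + t w, and
    as w > 0 exactly one of them has median zero: t = - med (x / w).  This defines
    a continuous map c |-> S(c) ([balance_solution]).

    A solution of the scheme is S(c) where c is a fixed point of
    c |-> lambda(S(c)).  By the bounds on lambda, this map takes its values in
    the cube of the vectors with coordinates in [mu, lambda_oo], so it has
    a fixed point by Brouwer's theorem.

    Brouwer's theorem ([brouwer]) comes from a cubical form of Sperner's lemma.
    Give a grid one 0-1 label per coordinate, the i-th being 0 on the face
    x_i = 0 and 1 on the opposite face.  The sum, over the simplices
    (v_0, ..., v_n) of the standard triangulation, of the products of the
    f_i(v_i) - f_i(v_(i-1)) is a discrete integral of df_1 ... df_n; by Stokes'
    formula it depends modulo 2 on boundary values only, so it equals 1, and
    some simplex sees every label change ([cubical_sperner]).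

    The geometry of the mesh enters in four places.  Edges have a positive and
    finite (d-1)-dimensional Hausdorff measure ([measure_edge_gt0]): finite
    since a bounded piece of a hyperplane is covered by about N^(d-1) pieces of
    size 1/N ([hyperplane_grid]), positive since a Lipschitz projection to
    R^(d-1) sends a null set to a null set ([hausdorff0_image]).  The line
    joining the centres of K and L crosses the edge between them
    ([separates_foot]), so the cells lie on opposite sides and each edge has at
    most two cells.  Each interior edge does separate two cells
    ([neighbour_ex]): its far side is covered by the closures of finitely many
    cells, one of which must contain a relatively open piece of the edge.
    Finally, two families of cells covering Omega and sharing no interior edge
    would meet in Omega along a set of null (d-1)-dimensional measure, too small to stop a
    bundle of parallel segments that goes from a cell of the first family to a
    cell of the second. *)

(** * A cubical form of Sperner's lemma *)

Lemma addF2_self (x : 'F_2) : x + x = 0.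
Proof. by rewrite -mulr2n -mulr_natl (_ : 2%:R = 0 :> 'F_2) ?mul0r//; apply: val_inj. Qed.

Lemma oppF2 (x : 'F_2) : - x = x.
Proof. by apply/eqP; rewrite eq_sym -addr_eq0 addF2_self. Qed.

Section Walks.
Variables (n N : nat).
Notation node := {ffun 'I_n -> nat}.
Notation base := {ffun 'I_n -> 'I_N}.

(** The vertices of the simplices of the Freudenthal triangulation of the
    grid: from the corner [z] of a unit cube to the opposite corner,
    coordinate [i] being raised at step [b i]. *)
Definition walk (z : base) (b : 'S_n) (k : nat) : node :=
  [ffun i => (z i + (b i < k))%N].

(** Modulo 2, the permutations cancel in pairs [b], [b * tperm i j], one
    even and one odd. *)
Lemma sum_tperm_invariant (G : base -> 'S_n -> 'F_2) (i j : 'I_n) : i != j ->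
  (forall z b, G z (b * tperm i j)%g = G z b) ->
  \sum_z \sum_b G z b = 0.
Proof.
move=> ij GE; rewrite big1// => z _.
rewrite (bigID (fun b : 'S_n => odd_perm b)) /=.
have -> : \sum_(b : 'S_n | odd_perm b) G z b = \sum_(b : 'S_n | ~~ odd_perm b) G z b.
  rewrite (reindex_inj (mulIg (tperm i j))) /=; apply: eq_big => b.
    by rewrite odd_permM odd_tperm ij addbT.
  by move=> _; rewrite GE.
exact: addF2_self.
Qed.

(** Exchanging two consecutive steps moves only the vertex between them: the
    two simplices share the opposite face. *)
Lemma walk_tperm z b k (i j : 'I_n) m : val i = k -> val j = k.+1 -> m != k.+1 ->
  walk z (b * tperm i j)%g m = walk z b m.
Proof.
move=> ik jk mk; apply/ffunP => l; rewrite !ffunE permM.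
case: tpermP => [->|->|//]; rewrite ik jk; congr addn; congr nat_of_bool;
 move: mk; case: ltngtP => //; case: ltngtP => //; lia.
Qed.

End Walks.

Section Coboundary.
Variables (n N : nat).
Notation node := {ffun 'I_n.+1 -> nat}.
Notation base := {ffun 'I_n.+1 -> 'I_N}.
Variables (f : 'I_n.+1 -> node -> 'F_2) (i : 'I_n.+1) (h : node -> 'F_2).

(** For [w] a walk, [s j] the step at which [f j] is differenced and [q] the
    place where [h] is read, this is the cup product of the [df_j], with [h]
    in place of [df_i], on a face of the simplex. Signs are irrelevant
    modulo 2, so differences are written as sums. *)
Definition cochain (w : nat -> node) (s : 'I_n.+1 -> nat) (q : nat) : 'F_2 :=
  h (w q) * \prod_(j | j != i) (f j (w (s j).+1) + f j (w (s j))).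

(** Differencing [f j0] at step [k] or at step [k + 1] gives the same sum:
    the two products differ by one where [f j0] is differenced between the
    vertices [k] and [k + 2], which does not see the vertex [k + 1], and so
    vanishes by [sum_tperm_invariant]. *)
Lemma cochain_shift (s s' : 'I_n.+1 -> nat) q (j0 : 'I_n.+1) k :
  j0 != i -> s j0 = k -> s' j0 = k.+1 -> (k < n)%N -> q != k.+1 ->
  (forall j, j != j0 -> j != i -> [/\ s' j = s j, s j != k & s j != k.+1]) ->
  \sum_(z : base) \sum_(b : 'S_n.+1) cochain (walk z b) s q =
  \sum_(z : base) \sum_(b : 'S_n.+1) cochain (walk z b) s' q.
Proof.
move=> j0i sk s'k kn qk ss'; apply/eqP; rewrite -subr_eq0 -sumrB; apply/eqP.
under eq_bigr do rewrite -sumrB.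
have kn1 : (k < n.+1)%N by lia.
have kn2 : (k.+1 < n.+1)%N by lia.
pose x := Ordinal kn1; pose y := Ordinal kn2.
apply: (@sum_tperm_invariant _ _ _ x y).
  by apply/eqP => /(congr1 val) /=; lia.
move=> z b; have V m : m != k.+1 -> walk z (b * tperm x y)%g m = walk z b m.
  exact: (@walk_tperm _ _ z b k).
rewrite /cochain V//.
have E (w : nat -> node) :
  h (w q) * \prod_(j | j != i) (f j (w (s j).+1) + f j (w (s j))) -
  h (w q) * \prod_(j | j != i) (f j (w (s' j).+1) + f j (w (s' j))) =
  h (w q) * ((f j0 (w k.+2) + f j0 (w k)) *
   \prod_(j | (j != i) && (j != j0)) (f j (w (s j).+1) + f j (w (s j)))).
  rewrite -mulrBr; congr (_ * _); rewrite (bigD1 j0)//= (bigD1 j0 (F := fun j => f j (w (s' j).+1) + _))//=.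
  have -> : \prod_(j | (j != i) && (j != j0)) (f j (w (s' j).+1) + f j (w (s' j)))
      = \prod_(j | (j != i) && (j != j0)) (f j (w (s j).+1) + f j (w (s j))).
    by apply: eq_bigr => j /andP[ji jj0]; have [-> _ _] := ss' _ jj0 ji.
  rewrite -mulrBl sk s'k oppF2; congr (_ * _).
  by rewrite addrC addrA -(addrA (f j0 (w k.+2))) addF2_self addr0.
have VQ := E (walk z b); rewrite VQ {VQ}.
have VQ := E (walk z (b * tperm x y)%g); rewrite V// in VQ; rewrite VQ {VQ}.
rewrite !V; [|lia|lia]; congr (_ * (_ * _)); apply: eq_bigr => j /andP[ji jj0].
have [_ s1 s2] := ss' _ jj0 ji; rewrite !V//.
Qed.

Lemma cochain_ext w w' s s' q q' : w q = w' q' ->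
  (forall j, j != i -> w (s j) = w' (s' j) /\ w (s j).+1 = w' (s' j).+1) ->
  cochain w s q = cochain w' s' q'.
Proof.
by move=> qq ss; rewrite /cochain qq; congr (_ * _); apply: eq_bigr => j /ss[-> ->].
Qed.

(* The two families of steps interpolate between the terms of the Leibniz
   expansion of df_0 ... dh ... df_n, in which h is read at the end or at the
   start of step i, and the outer faces, omitting the first or the last vertex. *)
Let lower_time k (j : 'I_n.+1) := if (k <= j < i)%N then j.+1 else nat_of_ord j.
Let upper_time k (j : 'I_n.+1) := if (i < j <= k)%N then j.-1 else nat_of_ord j.

Lemma sum_lower_shift k : (k <= i)%N ->
  \sum_(z : base) \sum_(b : 'S_n.+1) cochain (walk z b) (lower_time k) i.+1 =
  \sum_(z : base) \sum_(b : 'S_n.+1) cochain (walk z b) (lower_time 0) i.+1.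
Proof.
elim: k => // k IH ki; rewrite -IH; last by lia.
have ni := ltn_ord i.
have kn : (k < n.+1)%N by lia.
apply: (@cochain_shift _ _ _ (Ordinal kn) k) => //; rewrite /lower_time /=; try lia.
- by apply/eqP => /(congr1 val) /=; lia.
- by case: ifP => //; lia.
- by rewrite leqnn ki.
- move=> j /eqP jk /eqP ji; have {}jk : nat_of_ord j <> k by move=> E; apply: jk; apply: val_inj.
  have {}ji : nat_of_ord j <> i by move=> E; apply: ji; apply: val_inj.
  by do 2!case: ifP => //; split; lia.
Qed.

Lemma sum_upper_shift k : (i + k <= n)%N ->
  \sum_(z : base) \sum_(b : 'S_n.+1) cochain (walk z b) (upper_time i) i =
  \sum_(z : base) \sum_(b : 'S_n.+1) cochain (walk z b) (upper_time (i + k)) i.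
Proof.
elim: k => [|k IH] ki; first by rewrite addn0.
rewrite IH; last by lia.
have kn : ((i + k).+1 < n.+1)%N by lia.
apply/esym; apply: (@cochain_shift _ _ _ (Ordinal kn) (i + k)) => //; rewrite /upper_time /=; try lia.
- by apply/eqP => /(congr1 val) /=; lia.
- by case: ifP => //; lia.
- by case: ifP => //; lia.
- move=> j /eqP jk /eqP ji.
  have {}jk : nat_of_ord j <> (i + k).+1 by move=> E; apply: jk; apply: val_inj.
  have {}ji : nat_of_ord j <> i by move=> E; apply: ji; apply: val_inj.
  by do 2!case: ifP => //; split; lia.
Qed.

Hypothesis h_bnd : forall x : node, x i = 0%N \/ x i = N -> h x = 0.
Hypothesis f_bnd : forall j (x y : node), x j = y j -> x j = 0%N \/ x j = N ->
  f j x = f j y.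

(** A simplex and its successor share a face: the first step of the walk is
    removed and appended at its end. The base is taken cyclically, which
    makes the map a bijection of a finite type; at the wrap-around the faces
    lie on the boundary of the cube, where the cochain is 0. *)
Definition advance (p : base * 'S_n.+1) : base * 'S_n.+1 :=
  ([ffun l => if p.2 l == ord0 then ordS (p.1 l) else p.1 l],
   (p.2 * perm (can_inj (@ord_predK n.+1)))%g).

Lemma advance_inj : injective advance.
Proof.
move=> [z b] [z' b'] [] E /mulIg bb'; rewrite -bb' in E *; congr pair.
apply/ffunP => l; move/ffunP : E => /(_ l); rewrite !ffunE /=.
by case: ifP => // _; apply: (can_inj (@ordSK N)).
Qed.

(** On a face of the cube [x_l] is constant: either [l = i] and [h] is 0
    there, or [f l] is constant and its difference is 0. *)
Lemma cochain_boundary (w : nat -> node) s q (l : 'I_n.+1) (c : nat) : (c = 0%N \/ c = N) -> w q l = c ->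
  (forall j, j != i -> w (s j) l = c /\ w (s j).+1 l = c) -> cochain w s q = 0.
Proof.
move=> cN wq ws; rewrite /cochain; have [li|li] := eqVneq l i.
  by rewrite h_bnd ?mul0r// -li wq.
have [w1 w2] := ws _ li.
rewrite (bigD1 l)//= (f_bnd (x := w (s l).+1) (y := w (s l))) ?addF2_self ?mul0r ?mulr0//.
  by rewrite w1 w2.
by rewrite w2.
Qed.

(** The face opposite to the first vertex of a simplex is the face opposite
    to the last vertex of the next one. *)
Lemma sum_outer_faces : \sum_(z : base) \sum_(b : 'S_n.+1) cochain (walk z b) (lower_time 0) i.+1 =
  \sum_(z : base) \sum_(b : 'S_n.+1) cochain (walk z b) (upper_time n) i.
Proof.
rewrite !pair_big /= [RHS](reindex_inj advance_inj) /=; apply: eq_bigr => -[z b] _ /=.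
pose l := (b^-1)%g ord0; have bl : b l = ord0 by rewrite /l permKV.
set z' := [ffun _ => _]; set b' := (b * _)%g.
have b'E k : b' k = ord_pred (b k) by rewrite permM permE.
have ni := ltn_ord i.
have b'l : b' l = n :> nat by rewrite b'E bl /= modn_small.
have bk k : k != l -> (b k = (b' k).+1 :> nat).
  move=> kl; have : b k != ord0 by rewrite -bl (inj_eq perm_inj).
  rewrite b'E; case: (b k) => -[|x] //= xn _.
  by rewrite modnDr modn_small //; lia.
(* The wrap-around case: both faces lie in the boundary of the cube. *)
have [zl|zl] := leqP N (z l).+1.
  have zN : (z l).+1 = N by have := ltn_ord (z l); lia.
  rewrite (@cochain_boundary _ _ _ l N); [|by right| |].
  - rewrite (@cochain_boundary _ _ _ l 0%N) //; first by left.
    + by rewrite !ffunE bl eqxx /= b'l zN modnn; lia.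
    + move=> j /eqP ji; have nj := ltn_ord j.
      have {}ji : nat_of_ord j <> i by move=> E; apply: ji; apply: val_inj.
      by rewrite !ffunE bl eqxx /= b'l zN modnn /upper_time; case: ifP; lia.
  - by rewrite !ffunE bl /=; lia.
  - move=> j /eqP ji.
    have {}ji : nat_of_ord j <> i by move=> E; apply: ji; apply: val_inj.
    by rewrite !ffunE bl /= /lower_time; case: ifP => H /=; lia.
have V m : (m <= n)%N -> walk z b m.+1 = walk z' b' m.
  move=> mn; apply/ffunP => k; rewrite !ffunE.
  have [->|kl] := eqVneq k l.
    by rewrite bl eqxx /= b'l modn_small//; lia.
  by rewrite -bl (inj_eq perm_inj) (negbTE kl) bk.
apply: cochain_ext; first by apply: V; lia.
move=> j /eqP ji; have nj := ltn_ord j.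
have {}ji : nat_of_ord j <> i by move=> E; apply: ji; apply: val_inj.
have [ji'|ij] := ltnP j i.
  have -> : lower_time 0 j = j.+1 by rewrite /lower_time ji'.
  have -> : upper_time n j = j by rewrite /upper_time; case: ifP; lia.
  by split; apply: V; lia.
have -> : lower_time 0 j = j by rewrite /lower_time; case: ifP; lia.
have -> : upper_time n j = j.-1 by rewrite /upper_time; case: ifP; lia.
have -> : nat_of_ord j = j.-1.+1 by lia.
by split; apply: V => /=; lia.
Qed.

(** Stokes' formula: [h] vanishing on the faces [x_i = 0] and [x_i = N] and
    the other [f j] being constant on theirs, there is no boundary term. *)
Lemma sum_coboundary (g := fun j => if j == i then h else f j) :
  \sum_(z : base) \sum_(b : 'S_n.+1)
     \prod_(j < n.+1) (g j (walk z b j.+1) - g j (walk z b j)) = 0.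
Proof.
have ni := ltn_ord i.
transitivity (\sum_(z : base) \sum_(b : 'S_n.+1)
   (cochain (walk z b) (lower_time i) i.+1 + cochain (walk z b) (upper_time i) i)).
  apply: eq_bigr => z _; apply: eq_bigr => b _.
  rewrite (bigD1 i)//= {1 2}/g eqxx oppF2 mulrDl /cochain.
  congr (_ * _ + _ * _); apply: eq_bigr => j ji; rewrite /g (negbTE ji) oppF2;
   by rewrite /lower_time /upper_time; case: ifP => //; lia.
under eq_bigr do rewrite big_split.
rewrite big_split /= sum_lower_shift// (@sum_upper_shift (n - i)); last by lia.
by rewrite subnKC -1?ltnS// sum_outer_faces addF2_self.
Qed.
End Coboundary.

Section CubicalSperner.
Variables (n N : nat).
Notation node := {ffun 'I_n.+1 -> nat}.
Notation base := {ffun 'I_n.+1 -> 'I_N.+1}.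

(** The degree modulo 2 of a labelling, as the integral of [df_0 ... df_n]
    over the grid. *)
Definition label_degree (f : 'I_n.+1 -> node -> 'F_2) : 'F_2 :=
  \sum_(z : base) \sum_(b : 'S_n.+1)
     \prod_(j < n.+1) (f j (walk z b j.+1) - f j (walk z b j)).

Definition boundary_value (f : 'I_n.+1 -> node -> 'F_2) := forall j (x : node),
  (x j = 0%N -> f j x = 0) /\ (x j = N.+1 -> f j x = 1).

Definition coord_label (j : 'I_n.+1) (x : node) : 'F_2 := (0 < x j)%N%:R.

Lemma coord_label_bnd : boundary_value coord_label.
Proof. by move=> j x; rewrite /coord_label; split => ->. Qed.

(** A product is nonzero only if step [j] raises coordinate [j] from 0 for
    every [j], hence only for the simplex with base 0 and steps in the
    natural order. *)
Lemma label_degree_coord : label_degree coord_label = 1.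
Proof.
rewrite /label_degree (bigD1 [ffun => ord0]) //= (bigD1 1%g) //=.
rewrite [X in X + _ + _]big1; last first.
  by move=> j _; rewrite /coord_label !ffunE perm1 ltnS leqnn ltnn subr0.
rewrite [X in _ + X + _]big1 ?addr0 => [|b b1]; last first.
  have /existsP[j bj] : [exists j, b j != j].
    apply: contraR b1 => /existsPn bj; apply/eqP/permP => j; rewrite perm1.
    by have := bj j; rewrite negbK => /eqP.
  rewrite (bigD1 j)//= /coord_label !ffunE /= !add0n ltnS.
  case: (ltngtP (b j) j) => [_|_|/val_inj E]; rewrite ?subrr ?mul0r//.
  by rewrite E eqxx in bj.
rewrite big1 ?addr0// => z z0; apply: big1 => b _.
have /existsP[j zj] : [exists j, z j != ord0].
  apply: contraR z0 => /existsPn bj; apply/eqP/ffunP => j; rewrite ffunE.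
  by have := bj j; rewrite negbK => /eqP.
have {}zj : (0 < z j)%N by move: zj; rewrite -val_eqE /=; lia.
by rewrite (bigD1 j)//= /coord_label !ffunE !addn_gt0 zj /= subrr mul0r.
Qed.

(** The degree is additive in each label, and the difference of two
    admissible labels vanishes on the boundary faces that matter. *)
Lemma label_degree_replace (f g : 'I_n.+1 -> node -> 'F_2) i :
  boundary_value f -> boundary_value g -> (forall j, j != i -> f j = g j) ->
  label_degree f = label_degree g.
Proof.
move=> bf bg fg; apply/eqP; rewrite -subr_eq0 /label_degree -sumrB; apply/eqP.
pose h (x : node) : 'F_2 := f i x - g i x.
rewrite -[RHS](@sum_coboundary _ N.+1 f i h).
- apply: eq_bigr => z _; rewrite -sumrB; apply: eq_bigr => b _.
  rewrite (bigD1 i)//= (bigD1 i (F := fun j => g j _ - _))//= [RHS](bigD1 i)//=.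
  rewrite eqxx /h.
  have -> : \prod_(j | j != i) (g j (walk z b j.+1) - g j (walk z b j)) =
     \prod_(j | j != i) (f j (walk z b j.+1) - f j (walk z b j)).
    by apply: eq_bigr => j ji; rewrite fg.
  rewrite [X in _ = _ * X](eq_bigr (fun j => f j (walk z b j.+1) - f j (walk z b j))); last first.
    by move=> j /negbTE ->.
  by rewrite -mulrBl; congr (_ * _); rewrite !opprD !opprK addrACA.
- move=> x; rewrite /h; have [f0 f1] := bf i x; have [g0 g1] := bg i x.
  by case=> xi; [rewrite f0// g0//|rewrite f1// g1//]; exact: subrr.
- move=> j x y xy; have [f0 f1] := bf j x; have [g0 g1] := bf j y.
  by case=> xi; [rewrite f0// g0// -xy|rewrite f1// g1// -xy].
Qed.

(** The labels are replaced one by one by the coordinate labels. *)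
Lemma label_degree1 f : boundary_value f -> label_degree f = 1.
Proof.
move=> bf; pose g k (j : 'I_n.+1) := if (j < k)%N then coord_label j else f j.
have bg k : boundary_value (g k).
  by move=> j x; rewrite /g; case: ifP => _; [exact: coord_label_bnd|exact: bf].
rewrite -label_degree_coord.
transitivity (label_degree (g 0%N)); first by [].
transitivity (label_degree (g n.+1)); last first.
  apply: eq_bigr => z _; apply: eq_bigr => b _; apply: eq_bigr => j _.
  by rewrite /g ltn_ord.
have: (n.+1 <= n.+1)%N by [].
elim: {1 3}n.+1 => // k IH kn; rewrite IH ?(ltnW kn)//.
apply: (@label_degree_replace _ _ (Ordinal kn)) => // j.
by rewrite -val_eqE /g /= ltnS => jk; rewrite [(j <= k)%N]leq_eqVlt (negbTE jk).
Qed.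

Lemma cubical_sperner (f : 'I_n.+1 -> node -> bool) :
  (forall j (x : node), x j = 0%N -> f j x = false) ->
  (forall j (x : node), x j = N.+1 -> f j x = true) ->
  exists (z : base) (b : 'S_n.+1), forall j : 'I_n.+1,
    f j (walk z b j.+1) != f j (walk z b j).
Proof.
move=> f0 f1; have := @label_degree1 (fun j x => (f j x)%:R).
case: (pselect (exists (z : base) (b : 'S_n.+1), forall j : 'I_n.+1,
    f j (walk z b j.+1) != f j (walk z b j))) => // H.
rewrite /label_degree big1 => [K|z _].
  suff /eqP : 0 = 1 :> 'F_2 by [].
  by apply: K => j x; split => [/f0|/f1] ->.
apply: big1 => b _.
have /existsP[j /eqP E] : [exists j, f j (walk z b j.+1) == f j (walk z b j)].
  apply: contra_notT H => /existsPn H; by exists z, b.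
by rewrite (bigD1 j)//= E subrr mul0r.
Qed.
End CubicalSperner.

(** * Brouwer's fixed point theorem *)

Section Brouwer.
Variables (R : realType) (n : nat).

(** The [j]-th label of a grid point [x] is 1 when [g] does not move it
    forwards in direction [j], except on the face [x_j = a], where it is 0.
    On a simplex where all labels change, each coordinate of [g x - x] takes
    both signs, in the wide sense; a cluster point of such simplices, for
    finer and finer grids, is a fixed point. *)
Lemma brouwer_succ (g : 'rV[R]_n.+1 -> 'rV[R]_n.+1) (a b : R) :
  continuous g -> (forall x i, a <= g x ord0 i <= b) -> exists x, g x = x.
Proof.
move=> gc gab.
have ab : a <= b by have /andP[/le_trans h /h] := gab 0 ord0.
pose p N (v : {ffun 'I_n.+1 -> nat}) : 'rV[R]_n.+1 :=
  \row_i (a + (b - a) * ((v i)%:R / N.+1%:R)).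
have pE N v i : p N v ord0 i = a + (b - a) * ((v i)%:R / N.+1%:R) by rewrite mxE.
pose lab N (j : 'I_n.+1) (v : {ffun 'I_n.+1 -> nat}) := (0 < v j)%N && (g (p N v) ord0 j <= p N v ord0 j).
have K N : exists zb : {ffun 'I_n.+1 -> 'I_N.+1} * 'S_n.+1, forall j : 'I_n.+1,
    lab N j (walk zb.1 zb.2 j.+1) != lab N j (walk zb.1 zb.2 j).
  have [|j x xj|z [s H]] := @cubical_sperner n N (lab N); last by exists (z, s).
    by move=> j x xj; rewrite /lab xj.
  rewrite /lab xj /= pE xj divff ?pnatr_eq0// mulr1 addrC subrK.
  by have /andP[] := gab (p N x) j.
pose zb N := sval (cid (K N)); have zbP N (j : 'I_n.+1) :
    lab N j (walk (zb N).1 (zb N).2 j.+1) != lab N j (walk (zb N).1 (zb N).2 j).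
  exact: svalP (cid (K N)) j.
pose x_ N := p N (walk (zb N).1 (zb N).2 0).
have close N m i : a <= x_ N ord0 i <= b /\
    `|x_ N ord0 i - p N (walk (zb N).1 (zb N).2 m) ord0 i| <= (b - a) / N.+1%:R.
  rewrite /x_ !pE !ffunE ltn0 addn0; set z := (zb N).1 i; split.
    have zN : 0 <= (z%:R / N.+1%:R : R) <= 1.
      by rewrite divr_ge0//= ler_pdivrMr ?ltr0n// mul1r ler_nat ltnW.
    case/andP: zN; set t := _ / _ => t0 t1.
    have ba : 0 <= b - a by rewrite subr_ge0.
    have := mulr_ge0 ba t0; have := ler_wpM2l ba t1; rewrite mulr1.
    by move=> *; apply/andP; split; lra.
  rewrite opprD addrACA subrr add0r -mulrBr -mulrBl natrD opprD addrA subrr add0r.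
  rewrite normrM mulNr normrN ger0_norm ?subr_ge0//.
  rewrite ger0_norm; last by rewrite divr_ge0.
  apply: ler_wpM2l; first by rewrite subr_ge0.
  rewrite -[leRHS]mul1r; apply: ler_wpM2r; first by rewrite invr_ge0.
  by case: (_ < _)%N.
have := @rV_compact R n.+1 (fun=> `[a, b]%classic) (fun=> @segment_compact R a b).
move=> /(_ (x_ @ \oo) _)[].
  exists 0%N => // N _ /= i; rewrite in_itv /=.
  by have [] := close N 0%N i.
move=> x [_ xcl]; exists x; apply/rowP => j; apply/eqP; rewrite -subr_eq0.
pose F y := g y ord0 j - y ord0 j; rewrite -/(F x).
have Fc : {for x, continuous F}.
  apply: (@continuousB _ R^o _ (fun y : 'rV[R]_n.+1 => g y ord0 j : R^o)
    (fun y : 'rV[R]_n.+1 => y ord0 j : R^o)); last exact: coord_continuous.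
  exact: (@continuous_comp _ _ _ g (fun y : 'rV[R]_n.+1 => y ord0 j) x (gc x)
    (@coord_continuous _ _ _ _ _ _)).
have key (A : set R) : open A -> A (F x) ->
    exists y w, [/\ A (F y), A (F w), F y <= 0 & 0 <= F w].
  move=> oA AF; have /nbhs_ballP[e /= e0 eA] : nbhs x (F @^-1` A).
    by apply: Fc; apply: open_nbhs_nbhs.
  pose T := [set y | exists2 N, (b - a) / N.+1%:R < e / 2 & y = x_ N].
  (* Only the grids of mesh less than e/2 are kept: the simplex around x_ N
     then lies in the ball of radius e once x_ N lies in that of radius e/2. *)
  have [] := xcl T (ball x (e / 2)).
  - have : \forall N \near \oo, (b - a) / N.+1%:R < e / 2.
      have [->|] := eqVneq (b - a) 0.
        by near=> N; rewrite mul0r divr_gt0.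
      move=> ba0; near=> N.
      rewrite ltr_pdivrMr ?ltr0n// mulrC -ltr_pdivrMr ?divr_gt0//.
      rewrite (lt_le_trans (_ : _ < N%:R)) ?ler_nat//.
      near: N; exact: nbhs_infty_gtr.
    by apply: filterS => N HN; exists N.
  - exact: nbhsx_ballx (divr_gt0 e0 _).
  move=> _ [[N Ne ->] xN].
  have B m : A (F (p N (walk (zb N).1 (zb N).2 m))).
    apply: eA; split => // i0 i; rewrite (ord1 i0 : i0 = ord0).
    have [_ c] := close N m i; have := xN.2 ord0 i.
    rewrite /ball /= => d; apply: (le_lt_trans (ler_distD (x_ N ord0 i) _ _)).
    by rewrite [ltRHS]splitr ltrD// (le_lt_trans c).
  have labT m : lab N j (walk (zb N).1 (zb N).2 m) ->
      F (p N (walk (zb N).1 (zb N).2 m)) <= 0.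
    by move=> /andP[_]; rewrite subr_le0.
  have labF m : ~~ lab N j (walk (zb N).1 (zb N).2 m) ->
      0 <= F (p N (walk (zb N).1 (zb N).2 m)).
    rewrite negb_and -leqNgt leqn0 -ltNge subr_ge0 => /orP[/eqP vj|/ltW//].
    by rewrite pE vj mul0r mulr0 addr0; have /andP[] := gab (p N (walk (zb N).1 (zb N).2 m)) j.
  have := zbP N j; case E1: (lab _ _ _); case E2: (lab _ _ _) => // _.
    by exists (p N (walk (zb N).1 (zb N).2 j.+1)), (p N (walk (zb N).1 (zb N).2 j)); split => //;
      [exact: labT|apply: labF; rewrite E2].
  by exists (p N (walk (zb N).1 (zb N).2 j)), (p N (walk (zb N).1 (zb N).2 j.+1)); split => //;
      [exact: labT|apply: labF; rewrite E1].
apply/eqP/le_anti/andP; split; rewrite leNgt; apply/negP => Fx.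
  by have [y [w [/= h _ /le_lt_trans /(_ h)]]] := key _ (@open_gt R 0) Fx; rewrite ltxx.
by have [y [w [/= _ h _ /le_lt_trans /(_ h)]]] := key _ (@open_lt R 0) Fx; rewrite ltxx.
Unshelve. all: by end_near.
Qed.

End Brouwer.

Lemma brouwer (R : realType) n (g : 'rV[R]_n -> 'rV[R]_n) (a b : R) :
  continuous g -> (forall x i, a <= g x ord0 i <= b) -> exists x, g x = x.
Proof.
case: n g => [g _ _|n g]; last exact: brouwer_succ.
by exists 0; apply/rowP => -[].
Qed.

(** * Conservative operators on a connected graph *)

Section Balance.
Variables (R : realFieldType) (C E : finType).
Variables (Ed : C -> {set E}) (nb : C -> E -> C).
Hypothesis nbE : forall K s, s \in Ed K -> s \in Ed (nb K s).
Hypothesis nbK : forall K s, s \in Ed K -> nb (nb K s) s = K.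

(** The net outflow of mass from [K] when the mass of [K] leaves through the
    edge [s] at rate [p K s]; what enters [K] through [s] leaves the
    neighbour through [s]. *)
Definition balance (p : C -> E -> R) (u : C -> R) (K : C) : R :=
  \sum_(s in Ed K) (p K s * u K - p (nb K s) s * u (nb K s)).

(** The map sending (K, s) to (neighbour of K across s, s) is an involution. *)
Lemma sum_across (g : C -> E -> R) :
  \sum_K \sum_(s in Ed K) g (nb K s) s = \sum_K \sum_(s in Ed K) g K s.
Proof.
rewrite !pair_big_dep /=.
pose h (q : C * E) := (nb q.1 q.2, q.2).
rewrite [RHS](reindex_onto h h) /=; last by move=> [K s] /= sK; rewrite /h /= nbK.
apply: eq_bigl => -[K s] /=; apply/idP/idP => [sK|/andP[sK /eqP[E1]]].
  by rewrite nbE// /h /= nbK// eqxx.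
by rewrite -E1 nbE.
Qed.

Lemma sum_balance p u : \sum_K balance p u K = 0.
Proof.
rewrite /balance; under eq_bigr do rewrite sumrB.
by rewrite sumrB (sum_across (fun K s => p K s * u K)) subrr.
Qed.

Lemma balanceD p u v K : balance p (u \+ v) K = balance p u K + balance p v K.
Proof. by rewrite /balance -big_split; apply: eq_bigr => s _ /=; ring. Qed.

Lemma balanceZ p a u K : balance p (fun L => a * u L) K = a * balance p u K.
Proof. by rewrite /balance mulr_sumr; apply: eq_bigr => s _ /=; ring. Qed.

Hypothesis connect : forall S : {set C}, S != finset.set0 ->
  (forall K s, K \in S -> s \in Ed K -> nb K s \in S) -> S = [set: C]%SET.

Variable p : C -> E -> R.
Hypothesis p_gt0 : forall K s, s \in Ed K -> 0 < p K s.

(** Where a nonnegative stationary state vanishes, so do the inflows, hence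
    the state of each neighbour: the zero set is closed under neighbours. *)
Lemma balance_ker_ge0 y K0 : (forall K, 0 <= y K) ->
  (forall K, balance p y K = 0) -> y K0 = 0 -> forall K, y K = 0.
Proof.
move=> y0 Ay yK0 K.
have : [set K | y K == 0]%SET = [set: C]%SET.
  apply: connect; first by apply/finset.set0Pn; exists K0; rewrite inE yK0.
  move=> L s; rewrite !inE => /eqP yL sL.
  move: (Ay L); rewrite /balance.
  under eq_bigr do rewrite yL mulr0 sub0r.
  rewrite sumrN => /eqP; rewrite oppr_eq0 psumr_eq0; last first.
    by move=> t tL; apply: mulr_ge0 => //; apply: ltW; apply: p_gt0; apply: nbE.
  move=> /allP /(_ s); rewrite mem_index_enum sL /= => /(_ isT).
  by rewrite mulf_eq0 (gt_eqF (p_gt0 (nbE sL))).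
by move=> /setP /(_ K); rewrite !inE => /eqP.
Qed.

(** The triangle inequality makes the balance of [|u|] nonpositive
    everywhere; as these balances sum to zero, they all vanish. *)
Lemma balance_ker_norm u : (forall K, balance p u K = 0) ->
  forall K, balance p (fun L => `|u L|) K = 0.
Proof.
move=> Au.
have Ale K : 0 <= - balance p (fun L => `|u L|) K.
  have : \sum_(s in Ed K) p K s * u K = \sum_(s in Ed K) p (nb K s) s * u (nb K s).
    by apply/eqP; rewrite -subr_eq0 -sumrB; apply/eqP; exact: Au.
  rewrite /balance sumrB opprB subr_ge0 -!mulr_suml.
  have P0 : 0 <= \sum_(s in Ed K) p K s.
    by apply: sumr_ge0 => s sK; rewrite ltW// p_gt0.
  rewrite -{2}(ger0_norm P0) -normrM => ->.
  apply: le_trans (ler_norm_sum _ _ _) _.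
  apply: ler_sum => s sK; rewrite normrM ger0_norm// ltW// p_gt0// nbE//.
have /eqP := sum_balance p (fun L => `|u L|).
rewrite -oppr_eq0 -sumrN psumr_eq0// => /allP H K.
by apply/eqP; rewrite -oppr_eq0; apply: H; rewrite mem_index_enum.
Qed.

(** If [u] is nonnegative somewhere, the stationary state [|u| - u] vanishes
    there, hence everywhere. *)
Lemma balance_ker_sign u : (forall K, balance p u K = 0) ->
  (forall K, 0 <= u K) \/ (forall K, u K <= 0).
Proof.
move=> Au; have Anu := balance_ker_norm Au.
have [|/existsPn uK] := boolP [exists K, 0 <= u K]; last first.
  by right=> K; rewrite ltW// ltNge uK.
move=> /existsP[K0 uK0]; left => K.
suff : `|u K| + -1 * u K = 0.
  by move/eqP; rewrite mulN1r subr_eq0 => /eqP <-.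
apply: (@balance_ker_ge0 (fun K => `|u K| + -1 * u K) K0) => [L|L|].
- by rewrite mulN1r subr_ge0 ler_norm.
- rewrite (balanceD p (fun K => `|u K|) (fun K => -1 * u K)).
  by rewrite balanceZ Au Anu mulr0 addr0.
- by rewrite ger0_norm// mulN1r subrr.
Qed.

Lemma balance_ker_sum0 u : (forall K, balance p u K = 0) ->
  \sum_K u K = 0 -> forall K, u K = 0.
Proof.
move=> Au /eqP su K; case: (balance_ker_sign Au) => u0.
  move: su; rewrite psumr_eq0// => /allP /(_ K); rewrite mem_index_enum => /(_ isT) /eqP.
  exact.
move: su; rewrite -oppr_eq0 -sumrN psumr_eq0; last by move=> L _; rewrite oppr_ge0.
by move=> /allP /(_ K); rewrite mem_index_enum => /(_ isT); rewrite oppr_eq0 => /eqP.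
Qed.

Lemma balance_ker_gt0 u : (forall K, balance p u K = 0) ->
  0 < \sum_K u K -> forall K, 0 < u K.
Proof.
move=> Au su K.
have u0 : forall K, 0 <= u K.
  case: (balance_ker_sign Au) => // u0.
  by move: su; rewrite ltNge => /negP[]; apply: sumr_le0.
rewrite lt_def u0 andbT; apply/eqP => uK.
have uz := balance_ker_ge0 u0 Au uK.
by move: su; rewrite big1 ?ltxx.
Qed.
End Balance.

(** * Linear systems depending continuously on a parameter *)

Lemma continuous_mul (R : realType) (T : topologicalType) (f g : T -> R) :
  continuous f -> continuous g -> continuous (fun x => f x * g x).
Proof. by move=> cf cg x; apply: (@continuousM _ _ f g x) => //; [exact: cf|exact: cg]. Qed.

Lemma continuous_add (R : realType) (T : topologicalType) (f g : T -> R) :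
  continuous f -> continuous g -> continuous (fun x => f x + g x).
Proof. by move=> cf cg x; apply: (@continuousD _ R^o _ f g x) => //; [exact: cf|exact: cg]. Qed.

Lemma continuous_sub (R : realType) (T : topologicalType) (f g : T -> R) :
  continuous f -> continuous g -> continuous (fun x => f x - g x).
Proof. by move=> cf cg x; apply: (@continuousB _ R^o _ f g x) => //; [exact: cf|exact: cg]. Qed.

Lemma continuous_cst (R : realType) (T : topologicalType) (c : R) :
  continuous (fun _ : T => c).
Proof. by move=> x; exact: cst_continuous. Qed.

Lemma continuous_fsum (R : realType) (T : topologicalType) (I : finType)
    (P : pred I) (F : I -> T -> R) : (forall i, P i -> continuous (F i)) ->
  continuous (fun x => \sum_(i | P i) F i x).
Proof. by move=> cF; apply: continuous_big => //; exact: add_continuous. Qed.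

Lemma continuous_fprod (R : realType) (T : topologicalType) (I : finType)
    (P : pred I) (F : I -> T -> R) : (forall i, P i -> continuous (F i)) ->
  continuous (fun x => \prod_(i | P i) F i x).
Proof. by move=> cF; apply: continuous_big => //; exact: mul_continuous. Qed.

Lemma continuous_det (R : realType) (T : topologicalType) n (A : T -> 'M[R]_n) :
  (forall i j, continuous (fun x => A x i j)) -> continuous (fun x => \det (A x)).
Proof.
move=> cA; apply: continuous_fsum => s _; apply: continuous_mul; first exact: continuous_cst.
by apply: (@continuous_fprod R T _ xpredT (fun i x => A x i (s i))) => i _.
Qed.

(** By Cramer's rule the entries are quotients of determinants. *)
Lemma continuous_invmx (R : realType) (T : topologicalType) n (A : T -> 'M[R]_n) :
  (forall i j, continuous (fun x => A x i j)) -> (forall x, A x \in unitmx) ->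
  forall i j, continuous (fun x => invmx (A x) i j).
Proof.
move=> cA uA i j.
have -> : (fun x => invmx (A x) i j) =
    (fun x => (\det (A x))^-1 * ((-1) ^+ (j + i) * \det (row' j (col' i (A x))))).
  by apply/funext => x; rewrite /invmx uA !mxE.
apply: continuous_mul.
  move=> x; apply: (@continuousV _ _ (fun x => \det (A x))); last exact: continuous_det.
  by have := uA x; rewrite unitmxE unitfE.
apply: continuous_mul; first exact: continuous_cst.
apply: (@continuous_det _ _ _ (fun x => row' j (col' i (A x)))) => k l.
have -> : (fun x => row' j (col' i (A x)) k l) = (fun x => A x (lift j k) (lift i l)).
  by apply/funext => y; rewrite !mxE.
exact: cA.
Qed.

Lemma continuous_solve (R : realType) (T : topologicalType) (C : finType)
    (a : T -> C -> C -> R) (b : C -> R) :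
  (forall K L, continuous (fun x => a x K L)) ->
  (forall x u, (forall K, \sum_L a x K L * u L = 0) -> forall K, u K = 0) ->
  exists S : T -> C -> R, (forall K, continuous (fun x => S x K)) /\
    forall x K, \sum_L a x K L * S x L = b K.
Proof.
move=> ca ker.
pose A x : 'M[R]_#|C| := \matrix_(i, j) a x (enum_val i) (enum_val j).
have AE x (w : 'cV[R]_#|C|) K :
    (A x *m w) (enum_rank K) ord0 = \sum_L a x K L * w (enum_rank L) ord0.
  rewrite mxE [RHS](reindex (@enum_val C C)) /=; last exact: onW_bij (enum_val_bij C).
  by apply: eq_bigr => j _; rewrite mxE enum_rankK enum_valK.
have uA x : A x \in unitmx.
  rewrite -unitmx_tr -row_free_unit -kermx_eq0; apply/rowV0P => w.
  move=> /sub_kermxP wA.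
  have Aw : A x *m w^T = 0 by apply: trmx_inj; rewrite trmx_mul trmxK wA trmx0.
  apply/rowP => i; rewrite mxE.
  have := ker x (fun L => w ord0 (enum_rank L)) _ (enum_val i).
  rewrite enum_valK; apply => K.
  have := AE x w^T K; rewrite Aw mxE => /esym; under eq_bigr do rewrite mxE.
  exact.
pose bv : 'cV[R]_#|C| := \col_i b (enum_val i).
exists (fun x K => (invmx (A x) *m bv) (enum_rank K) ord0); split.
  move=> K.
  have -> : (fun x => (invmx (A x) *m bv) (enum_rank K) ord0) =
      (fun x => \sum_j invmx (A x) (enum_rank K) j * bv j ord0).
    by apply/funext => x; rewrite mxE.
  apply: continuous_fsum => j _.
  apply: continuous_mul; last exact: continuous_cst.
  apply: continuous_invmx => // i k.
  have -> : (fun x => A x i k) = (fun x => a x (enum_val i) (enum_val k)).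
    by apply/funext => y; rewrite mxE.
  exact: ca.
move=> x K; have := AE x (invmx (A x) *m bv) K.
by rewrite mulKVmx// mxE enum_rankK => ->.
Qed.

(** * Weighted medians *)

Section Median.
Variables (R : realType) (C : finType) (m : C -> R).
Hypothesis m_gt0 : forall K, 0 < m K.
Variable K0 : C.

Let mass (P : pred C) : R := \sum_(K | P K) m K.

(** For a function with finitely many values this is a form of [med u = 0]
    that depends on the signs of [u] only. *)
Definition zero_median (u : C -> R) : Prop :=
  2 * mass (fun K => 0 < u K) <= \sum_K m K /\
  \sum_K m K < 2 * mass (fun K => 0 <= u K).

Let above (z : C -> R) := [set t | 2 * mass (fun K => t < z K) <= \sum_K m K].

Definition cell_median (z : C -> R) : R := inf (above z).

Let mass_le (P Q : pred C) : {subset P <= Q} -> mass P <= mass Q.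
Proof.
move=> PQ; rewrite /mass big_mkcond [leRHS]big_mkcond /=; apply: ler_sum => K _.
by case: ifPn => [/PQ|_]; [rewrite unfold_in => ->|case: ifP => // _; rewrite ltW].
Qed.

Let total_gt0 : 0 < \sum_K m K.
Proof.
by rewrite (bigD1 K0)//= ltr_pwDl// sumr_ge0// => K _; rewrite ltW.
Qed.

Let above_nonempty z : above z !=set0.
Proof.
exists (\sum_K `|z K|); rewrite /above /= /mass big1 ?mulr0 ?ltW//.
move=> K; rewrite ltNge => /negP[]; apply: le_trans (ler_norm _) _.
by rewrite (bigD1 K)//= lerDl sumr_ge0.
Qed.

Let above_lb z : lbound (above z) (- \sum_K `|z K|).
Proof.
move=> t; rewrite /above /= leNgt => /negP H; rewrite leNgt; apply/negP => tz; apply: H.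
rewrite [mass _](_ : _ = \sum_K m K); first by have := total_gt0; lra.
apply: eq_bigl => K; apply: lt_le_trans tz _; rewrite lerNl; apply: le_trans (ler_norm _) _.
by rewrite normrN (bigD1 K)//= lerDl sumr_ge0.
Qed.

Let above_inf z : has_inf (above z).
Proof. by split; [exact: above_nonempty|exists (- \sum_K `|z K|); exact: above_lb]. Qed.

Let above_up z s t : above z s -> s <= t -> above z t.
Proof.
rewrite /above /= => zs st; apply: le_trans zs; rewrite ler_pM2l//; apply: mass_le => K.
by rewrite !unfold_in; exact: le_lt_trans.
Qed.

(** The median is monotone and commutes with the addition of constants; it
    is thus 1-Lipschitz for the sup norm. *)
Lemma cell_median_le z z' e : (forall K, z' K <= z K + e) ->
  cell_median z' <= cell_median z + e.
Proof.
move=> zz'; rewrite -lerBlDr; apply: lb_le_inf; first exact: above_nonempty.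
move=> t zt; rewrite lerBlDr; apply: ge_inf; first by have [] := above_inf z'.
apply: le_trans zt; rewrite ler_pM2l//; apply: mass_le => K.
rewrite !unfold_in => tz'; rewrite -(ltrD2r e); exact: lt_le_trans tz' (zz' K).
Qed.

Lemma continuous_cell_median (T : topologicalType) (z : T -> C -> R) :
  (forall K, continuous (fun x => z x K)) -> continuous (fun x => cell_median (z x)).
Proof.
move=> cz x; apply/cvgrPdist_le => e e0.
have : \forall y \near x, forall K, `|z x K - z y K| <= e.
  apply: filter_forall => K.
  by have /cvgrPdist_le /(_ e e0) := cz K x.
apply: filterS => y xy.
have h1 : cell_median (z x) <= cell_median (z y) + e.
  by apply: cell_median_le => K; have := xy K; rewrite ler_norml => /andP[]; lra.
have h2 : cell_median (z y) <= cell_median (z x) + e.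
  by apply: cell_median_le => K; have := xy K; rewrite ler_norml => /andP[]; lra.
by rewrite ler_norml; apply/andP; split; lra.
Qed.

(** The half-mass condition on superlevel sets holds just above the infimum
    and fails just below it; a level close enough to the infimum separates
    it from the finitely many other values of [z]. *)
Lemma zero_median_sub z : zero_median (fun K => z K - cell_median z).
Proof.
set t0 := cell_median z; split.
  (* A level slightly above the median is still below all the larger values. *)
  have : \forall t \near t0^'+, forall K, t0 < z K -> t < z K.
    apply: filter_forall => K; have [t0K|_] := ltP t0 (z K).
      by near=> t => _; near: t; exact: nbhs_right_lt.
    by near=> t.
  move=> /(filterI (nbhs_right_gt t0))/filter_ex[t [/= tt0 tK]].
  have [t' zt' t't] : exists2 t', above z t' & t' < t.
    by apply: inf_lt => //; exact: above_inf.
  apply: le_trans (above_up zt' (ltW t't)); rewrite ler_pM2l//; apply: mass_le => K.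
  by rewrite !unfold_in subr_gt0; exact: tK.
(* A level slightly below the median is still above all the smaller values. *)
have : \forall t \near t0^'-, forall K, z K < t0 -> z K < t.
  apply: filter_forall => K; have [t0K|_] := ltP (z K) t0.
    by near=> t => _; near: t; exact: nbhs_left_gt.
  by near=> t.
move=> /(filterI (nbhs_left_lt t0))/filter_ex[t [/= tt0 tK]].
rewrite ltNge; apply/negP => H.
have zt : above z t.
  apply: le_trans H; rewrite ler_pM2l//; apply: mass_le => K.
  rewrite !unfold_in subr_ge0 => tzK; rewrite leNgt; apply/negP => /tK.
  by rewrite ltNge (ltW tzK).
by have := ge_inf (above_inf z).2 zt; rewrite leNgt tt0.
Unshelve. all: by end_near.
Qed.

Lemma zero_median_scale (w z : C -> R) : (forall K, 0 < w K) ->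
  zero_median z -> zero_median (fun K => w K * z K).
Proof.
move=> w0; rewrite /zero_median.
have -> : mass (fun K => 0 < w K * z K) = mass (fun K => 0 < z K).
  by apply: eq_bigl => K; rewrite pmulr_rgt0.
suff -> : mass (fun K => 0 <= w K * z K) = mass (fun K => 0 <= z K) by [].
by apply: eq_bigl => K; rewrite pmulr_rge0.
Qed.
End Median.

(** * The linear problem with prescribed median *)

(** Adding the rank-one term [m K * sum u] to the balance makes the system
    invertible: summing the equations gives the value of [sum u], so the
    solution for the datum [b] is a solution [X] of sum 0 of the balance
    equations, and the one for the datum [m] is a kernel element [W] of sum
    1, hence positive. The solution of median zero is then [W(X/W - t)] with
    [t] the median of [X/W], since a positive factor does not change signs. *)
Lemma balance_solution (R : realType) (T : topologicalType) (C E : finType)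
    (Ed : C -> {set E}) (nb : C -> E -> C) (K0 : C)
    (nbE : forall K s, s \in Ed K -> s \in Ed (nb K s))
    (nbK : forall K s, s \in Ed K -> nb (nb K s) s = K)
    (connect : forall S : {set C}, S != finset.set0 ->
      (forall K s, K \in S -> s \in Ed K -> nb K s \in S) -> S = [set: C]%SET)
    (p : T -> C -> E -> R) (m b : C -> R) :
  (forall x K s, s \in Ed K -> 0 < p x K s) ->
  (forall K s, continuous (fun x => p x K s)) ->
  (forall K, 0 < m K) -> \sum_K b K = 0 ->
  exists S : T -> C -> R, [/\ forall K, continuous (fun x => S x K),
    forall x, zero_median m (S x) & forall x K, balance Ed nb (p x) (S x) K = b K].
Proof.
move=> p0 cp m0 b0.
pose a x K L := balance Ed nb (p x) (fun M => (M == L)%:R) K + m K.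
have aE x u K : \sum_L a x K L * u L = balance Ed nb (p x) u K + m K * \sum_L u L.
  rewrite /a; under eq_bigr do rewrite mulrDl.
  rewrite big_split -mulr_sumr /=; congr (_ + _).
  rewrite /balance; under eq_bigr do rewrite mulr_suml.
  rewrite exchange_big /=; apply: eq_bigr => s _.
  under eq_bigr do rewrite mulrBl -!mulrA.
  rewrite sumrB -!mulr_sumr.
  have D M : \sum_L ((M == L)%:R * u L) = u M.
    rewrite (bigD1 M)//= eqxx mul1r big1 ?addr0// => L /negbTE.
    by rewrite eq_sym => ->; rewrite mul0r.
  by rewrite !D.
have ca K L : continuous (fun x => a x K L).
  apply: continuous_add; last exact: continuous_cst.
  apply: continuous_fsum => s _.
  by apply: continuous_sub; apply: continuous_mul; (exact: cp || exact: continuous_cst).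
have tot : 0 < \sum_K m K.
  by rewrite (bigD1 K0)//= ltr_pwDl// sumr_ge0// => K _; rewrite ltW.
have sumE x u c : (forall K, balance Ed nb (p x) u K + m K * \sum_L u L = c K) ->
    (\sum_K m K) * \sum_L u L = \sum_K c K.
  move=> H; rewrite -(eq_bigr _ (fun K _ => H K)) big_split /=.
  by rewrite sum_balance// add0r mulr_suml.
have ker x u : (forall K, \sum_L a x K L * u L = 0) -> forall K, u K = 0.
  move=> au; have {}au K : balance Ed nb (p x) u K + m K * \sum_L u L = 0 by rewrite -aE.
  have := sumE x u (fun=> 0) au; rewrite [RHS]big1// => /eqP; rewrite mulf_eq0 gt_eqF//= => /eqP su.
  apply: (balance_ker_sum0 nbE nbK connect (p0 x)) => // K.
  by rewrite -[RHS](au K) su mulr0 addr0.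
have [X [cX XE]] := continuous_solve b ca ker.
have [W [cW WE]] := continuous_solve m ca ker.
have sX x : \sum_L X x L = 0.
  have := sumE x (X x) b; rewrite b0 => /(_ _)/eqP.
  rewrite mulf_eq0 gt_eqF//= => H; apply/eqP; apply: H => K; by rewrite -aE XE.
have sW x : \sum_L W x L = 1.
  have := sumE x (W x) m => /(_ _)/eqP.
  rewrite -subr_eq0 -{2}(mulr1 (\sum_K m K)) -mulrBr mulf_eq0 gt_eqF//= subr_eq0 => H.
  by apply/eqP; apply: H => K; rewrite -aE WE.
have BX x K : balance Ed nb (p x) (X x) K = b K.
  by have := XE x K; rewrite aE sX mulr0 addr0.
have BW x K : balance Ed nb (p x) (W x) K = 0.
  by apply: (addIr (m K)); have := WE x K; rewrite aE sW mulr1 add0r.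
have W0 x K : 0 < W x K.
  by apply: (balance_ker_gt0 nbE nbK connect (p0 x)) => //; rewrite sW.
pose Z x K := X x K / W x K.
have cZ K : continuous (fun x => Z x K).
  apply: continuous_mul => // x; apply: (@continuousV _ _ (fun x => W x K)); last exact: cW.
  by rewrite gt_eqF.
exists (fun x K => W x K * (Z x K - cell_median m (Z x))); split.
- move=> K; apply: continuous_mul => //.
  by apply: continuous_sub => //; exact: continuous_cell_median.
- by move=> x; apply: zero_median_scale => //; exact: zero_median_sub.
- move=> x K.
  have -> : (fun K => W x K * (Z x K - cell_median m (Z x))) =
     X x \+ (fun K => - cell_median m (Z x) * W x K).
    by apply/funext => L /=; rewrite /Z; field; rewrite gt_eqF.
  by rewrite balanceD balanceZ BW mulr0 addr0 BX.
Qed.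

(** * Lebesgue measure of cubes and open sets *)

Section LebesgueMeasure.
Context {R : realType}.
Local Notation Rm := (measurableTypeR R).
Local Open Scope ereal_scope.

Section OuterMeasure.
Variable n : nat.
Implicit Types A B : set 'rV[R]_n.

Lemma le_leb A B : A `<=` B -> leb A <= leb B.
Proof. exact: (@le_mu_ext _ _ R (@borel_lebesgue_rV R n) A B). Qed.

Lemma leb_ge0 A : 0 <= leb A.
Proof. exact: (@mu_ext_ge0 _ _ R (@borel_lebesgue_rV R n)). Qed.

Lemma leb_set0 : leb (set0 : set 'rV[R]_n) = 0.
Proof. exact: (@mu_ext0 _ _ R (@borel_lebesgue_rV R n)). Qed.

Lemma leb_sigma_subadditive (F : (set 'rV[R]_n)^nat) :
  leb (\bigcup_i F i) <= \sum_(i <oo) leb (F i).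
Proof. exact: (@mu_ext_sigma_subadditive _ _ R (@borel_lebesgue_rV R n)). Qed.

Lemma leb_setU A B : leb (A `|` B) <= leb A + leb B.
Proof. exact: (outer_measureU2 (mu_ext (@borel_lebesgue_rV R n))). Qed.

Lemma leb_bigsetU (I : Type) (s : seq I) (F : I -> set 'rV[R]_n) :
  leb (\big[setU/set0]_(i <- s) F i) <= \sum_(i <- s) leb (F i).
Proof.
elim: s => [|i s IH]; first by rewrite !big_nil leb_set0.
by rewrite !big_cons; apply: le_trans (leb_setU _ _) _; rewrite leeD2l.
Qed.

Lemma leb_cover (I : finType) (F : I -> set 'rV[R]_n) A :
  A `<=` [set x | exists i, F i x] -> leb A <= \sum_i leb (F i).
Proof.
move=> AF; apply: le_trans (leb_bigsetU (index_enum I) F); apply: le_leb.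
move=> x /AF[i Fi]; rewrite -bigcup_seq; exists i => //=.
exact: mem_index_enum.
Qed.

Lemma leb_null_cover (I : finType) (F : I -> set 'rV[R]_n) A :
  (forall i, leb (F i) = 0) -> A `<=` [set x | exists i, F i x] -> leb A = 0.
Proof.
move=> F0 AF; apply/eqP; rewrite eq_le leb_ge0 andbT.
by apply: le_trans (leb_cover AF) _; rewrite big1.
Qed.

Lemma leb_null_sub A B : A `<=` B -> leb B = 0 -> leb A = 0.
Proof. by move=> AB B0; apply/eqP; rewrite eq_le leb_ge0 andbT -B0 le_leb. Qed.

(** The Caratheodory construction is complete. *)
Lemma measurable_leb_null A : leb A = 0 -> measurable (A : set (lebesgue_rV_type R n)).
Proof.
move=> A0; apply: le_caratheodory_measurable => X.
have XA : leb (X `&` A) = 0 by apply: (leb_null_sub _ A0); exact: subIsetr.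
apply: (@le_trans _ _ (leb (X `&` A) + leb (X `&` ~` A))) => //.
by rewrite XA add0e; apply: le_leb; exact: subIsetl.
Qed.

Lemma leb_borel (A : set (g_sigma_algebraType (@cylinders R n))) : measurable A ->
  measurable (A : set (lebesgue_rV_type R n)) /\ leb A = borel_lebesgue_rV A.
Proof.
move=> mA; split; first exact: caratheodory_measurable_mu_ext.
exact: measurable_mu_extE.
Qed.

Lemma borel_coord (B : 'I_n -> set Rm) : (forall i, measurable (B i)) ->
  measurable ([set x | forall i, B i (x ord0 i)] : set (g_sigma_algebraType (@cylinders R n))).
Proof.
move=> mB.
pose bT := g_sigma_algebraType (@cylinders R n).
rewrite [X in measurable X](_ : _ = \big[setI/[set: bT]]_(i <- index_enum 'I_n)
    [set x : bT | B i ((x : 'rV[R]_n) ord0 i)]); last first.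
  rewrite -bigcap_seq; apply/seteqP; split => x /= H i; first by move=> _; exact: H.
  by apply: H; exact: mem_index_enum.
apply: (@bigsetI_measurable _ (g_sigma_algebraType (@cylinders R n))) => i _.
by apply: sub_sigma_algebra; exists i, (B i).
Qed.

End OuterMeasure.

(** Measurability is part of the induction, as the product rule requires it.
    Sides are indexed by all of nat so that the tail of a box is the box of
    the shifted function. *)
Lemma lebesgue_tuple_cube n (a : nat -> R) (r : R) : (0 <= r)%R ->
  measurable [set t : n.-tuple Rm | forall i : 'I_n, (a i <= tnth t i <= a i + r)%R] /\
  lebesgue_tuple R n [set t : n.-tuple Rm | forall i : 'I_n, (a i <= tnth t i <= a i + r)%R]
  = (r ^+ n)%:E.
Proof.
move=> r0; have mI b : measurable [set x : Rm | (b <= x <= b + r)%R].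
  have -> : [set x : Rm | (b <= x <= b + r)%R] = `[b, (b + r)%R]%classic.
    by apply/seteqP; split => x /=; rewrite in_itv.
  exact: measurable_itv.
elim: n a => [|n IH] a.
  have -> : [set t : 0.-tuple Rm | forall i : 'I_0, (a i <= tnth t i <= a i + r)%R] = setT.
    by apply/seteqP; split => // t _ [].
  by split; [exact: measurableT|rewrite /= diracT].
split.
  have -> : [set t : n.+1.-tuple Rm | forall i : 'I_n.+1, (a i <= tnth t i <= a i + r)%R] =
    \big[setI/[set: n.+1.-tuple Rm]]_(i <- index_enum 'I_n.+1)
       ((@tnth n.+1 Rm ^~ i) @^-1` [set x : Rm | (a i <= x <= a i + r)%R]).
    rewrite -bigcap_seq; apply/seteqP; split => x /= H i; first by move=> _; exact: H.
    by apply: H; exact: mem_index_enum.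
  apply: bigsetI_measurable => i _.
  by rewrite -[X in measurable X]setTI; apply: measurable_tnth.
rewrite /= /lebesgue_cons /pushforward.
have [mS IHE] := IH (fun k => a k.+1).
have -> : @tcons R n @^-1` [set t : n.+1.-tuple Rm | forall i : 'I_n.+1, (a i <= tnth t i <= a i + r)%R]
   = [set x : Rm | (a 0%N <= x <= a 0%N + r)%R] `*`
     [set t : n.-tuple Rm | forall i : 'I_n, (a i.+1 <= tnth t i <= a i.+1 + r)%R].
  apply/seteqP; split => -[x t] /=.
    by move=> H; split => [|i]; [exact: (H ord0)|have := H (lift ord0 i); rewrite tnthS].
  by move=> [Hx Ht] i; case: (unliftP ord0 i) => [j ->|->]; [rewrite tnthS; exact: Ht|exact: Hx].
rewrite product_measure1E; [|exact: mI|exact: mS].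
rewrite [X in _ * X]IHE.
have -> : [set x : Rm | (a 0%N <= x <= a 0%N + r)%R] = [set` `[a 0%N, (a 0%N + r)%R]].
  by apply/seteqP; split => x /=; rewrite in_itv.
have := @lebesgue_measure_itv R `[a 0%N, (a 0%N + r)%R].
rewrite /= lte_fin ltrDl => ->.
move: r0; rewrite le_eqVlt => /orP[/eqP <-|r0].
  by rewrite ltxx mul0e exprS mul0r.
by rewrite r0 -EFinD -EFinM addrC addKr exprS.
Qed.

Definition cube n (a : 'rV[R]_n) (r : R) : set 'rV[R]_n :=
  [set x | forall i, (a ord0 i <= x ord0 i <= a ord0 i + r)%R].

Lemma leb_cube n (a : 'rV[R]_n) (r : R) : (0 <= r)%R -> leb (cube a r) = (r ^+ n)%:E.
Proof.
move=> r0; have [|_ ->] := @leb_borel n (cube a r).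
  apply: (@borel_coord n (fun i => [set x | (a ord0 i <= x <= a ord0 i + r)%R])) => i.
  have -> : [set x : Rm | (a ord0 i <= x <= a ord0 i + r)%R] = `[a ord0 i, (a ord0 i + r)%R]%classic.
    by apply/seteqP; split => x /=; rewrite in_itv.
  exact: measurable_itv.
(* The coordinates of a as a function on nat, completed by 0. *)
pose b k := if insub k is Some i then a ord0 i else 0%R.
have bE i : b (nat_of_ord i) = a ord0 i by rewrite /b valK.
have [_ <-] := @lebesgue_tuple_cube n b r r0.
rewrite /borel_lebesgue_rV /pushforward; congr (lebesgue_tuple _ _ _).
by apply/seteqP; split => t /= H i; have := H i; rewrite mxE bE.
Qed.

(** An open set is the union of the cubes of the grids of step 1/(k+1) that
    it contains; they are countably many. *)
Lemma measurable_open n (A : set 'rV[R]_n) : open A ->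
  measurable (A : set (lebesgue_rV_type R n)).
Proof.
move=> oA.
pose G (p : nat * {ffun 'I_n -> int}) := [set x : 'rV[R]_n | forall i,
  ((p.2 i)%:~R <= x ord0 i * p.1.+1%:R < (p.2 i + 1)%:~R)%R].
have mG p : measurable (G p : set (g_sigma_algebraType (@cylinders R n))).
  apply: (@borel_coord n (fun i => [set x : Rm |
    ((p.2 i)%:~R <= x * p.1.+1%:R < (p.2 i + 1)%:~R)%R])) => i.
  have -> : [set x : Rm | ((p.2 i)%:~R <= x * p.1.+1%:R < (p.2 i + 1)%:~R)%R] =
    `[((p.2 i)%:~R / p.1.+1%:R)%R, ((p.2 i + 1)%:~R / p.1.+1%:R)%R[%classic.
    by apply/seteqP; split => x /=; rewrite in_itv /= ler_pdivrMr ?ltr0n// ltr_pdivlMr ?ltr0n.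
  exact: measurable_itv.
pose F p := if pselect (G p `<=` A) then G p else set0.
have -> : A = \bigcup_p F p.
  apply/seteqP; split => [x Ax|x [p _]]; last by rewrite /F; case: pselect => // pA /pA.
  have /nbhs_ballP[e /= e0 eA] : nbhs x A by apply: open_nbhs_nbhs.
  have [k ke] : exists k : nat, (k.+1%:R^-1 < e)%R.
    exists (Num.truncn e^-1); rewrite invf_plt ?posrE ?ltr0n//.
    have e1 : (0 <= e^-1)%R by rewrite invr_ge0 ltW.
    by have /andP[] := truncn_itv e1.
  pose z := [ffun i => Num.floor (x ord0 i * k.+1%:R)%R].
  have Gx : G (k, z) x by move=> i; rewrite /= ffunE floor_itv.
  exists (k, z) => //; rewrite /F; case: pselect => // -[] y Gy.
  apply: eA; split => // i0 i; rewrite (ord1 i0 : i0 = ord0).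
  have := Gx i; have := Gy i; rewrite /= intrD => /andP[y1 y2] /andP[x1 x2].
  apply: le_lt_trans ke; rewrite -(@ler_pM2r _ k.+1%:R) ?ltr0n// mulVf ?pnatr_eq0//.
  rewrite -{1}(@ger0_norm _ k.+1%:R) ?ler0n// -normrM mulrBl ler_norml.
  by apply/andP; split; lra.
apply: countable_bigcupT_measurable => // p; rewrite /F.
by case: pselect => ?; [have [] := leb_borel (mG p)|exact: measurable0].
Qed.

End LebesgueMeasure.

(** * Euclidean norm and diameter *)

Section EuclideanNorm.
Context {R : realType} {n : nat}.
Implicit Types x y z a : 'rV[R]_n.

Lemma dotC x y : dot x y = dot y x.
Proof. by apply: eq_bigr => i _; rewrite mulrC. Qed.

Lemma dotDr a x y : dot a (x + y) = dot a x + dot a y.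
Proof. by rewrite /dot -big_split; apply: eq_bigr => i _; rewrite mxE mulrDr. Qed.

Lemma dotZr a t x : dot a (t *: x) = t * dot a x.
Proof. by rewrite /dot mulr_sumr; apply: eq_bigr => i _; rewrite mxE mulrCA. Qed.

Lemma dotNr a x : dot a (- x) = - dot a x.
Proof. by rewrite -scaleN1r dotZr mulN1r. Qed.

Lemma dotBr a x y : dot a (x - y) = dot a x - dot a y.
Proof. by rewrite dotDr dotNr. Qed.

Lemma dotZl a t x : dot (t *: a) x = t * dot a x.
Proof. by rewrite dotC dotZr dotC. Qed.

Lemma dotNl a x : dot (- a) x = - dot a x.
Proof. by rewrite dotC dotNr dotC. Qed.

Lemma dotBl x y a : dot (x - y) a = dot x a - dot y a.
Proof. by rewrite dotC dotBr !(dotC a). Qed.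

Lemma dot_ge0 x : 0 <= dot x x.
Proof. by apply: sumr_ge0 => i _; rewrite -expr2 sqr_ge0. Qed.

Lemma dot_eq0 x : (dot x x == 0) = (x == 0).
Proof.
apply/idP/eqP => [|->]; last by rewrite /dot big1// => i _; rewrite mxE mulr0.
rewrite /dot psumr_eq0 => [/allP x0|i _]; last by rewrite -expr2 sqr_ge0.
apply/rowP => i; rewrite mxE; apply/eqP.
by have := x0 i; rewrite mem_index_enum -expr2 sqrf_eq0; apply.
Qed.

Lemma dot_gt0 x : x != 0 -> 0 < dot x x.
Proof. by move=> x0; rewrite lt_def dot_eq0 x0 dot_ge0. Qed.

Lemma enorm_gt0 x : x != 0 -> 0 < enorm x.
Proof. by move=> x0; rewrite sqrtr_gt0 dot_gt0. Qed.

Lemma enormN x : enorm (- x) = enorm x.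
Proof. by rewrite /enorm dotNl dotNr opprK. Qed.

(** With [enorm_le_coord], this compares the Euclidean norm with the sup
    norm, which the topology of row vectors is defined from. *)
Lemma normr_coord_le x i : `|x ord0 i| <= enorm x.
Proof.
rewrite -sqrtr_sqr ler_sqrt ?dot_ge0// /dot (bigD1 i)//= -expr2 lerDl.
by apply: sumr_ge0 => j _; rewrite -expr2 sqr_ge0.
Qed.

Lemma enorm_le_sum x : enorm x <= \sum_i `|x ord0 i|.
Proof.
have s0 : 0 <= \sum_i `|x ord0 i| by apply: sumr_ge0.
rewrite -[leRHS](ger0_norm s0) -sqrtr_sqr ler_sqrt ?sqr_ge0// expr2 mulr_suml.
apply: ler_sum => i _; rewrite mulr_sumr (bigD1 i)//= -normrM.
rewrite ler_wpDr ?ler_norm//.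
by apply: sumr_ge0 => j _; rewrite mulr_ge0.
Qed.

Lemma enorm_le_coord x r : (forall i, `|x ord0 i| <= r) -> enorm x <= n%:R * r.
Proof.
move=> xr; apply: le_trans (enorm_le_sum x) _.
by apply: le_trans (ler_sum _ (fun i _ => xr i)) _; rewrite sumr_const card_ord mulr_natl.
Qed.

Lemma ediam_le (A : set 'rV[R]_n) r : 0 <= r ->
  (forall x y, A x -> A y -> forall i, `|x ord0 i - y ord0 i| <= r) ->
  (ediam A <= (n%:R * r)%:E)%E.
Proof.
move=> r0 Ar; apply: ge_ereal_sup => _ [->|[[x y] [/= Ax Ay] <-]].
  by rewrite lee_fin mulr_ge0.
rewrite lee_fin; apply: enorm_le_coord => i; rewrite !mxE; exact: Ar.
Qed.

Lemma ediam_ge0 (A : set 'rV[R]_n) : (0 <= ediam A)%E.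
Proof. by apply: ereal_sup_ubound; left. Qed.

Lemma enorm_le_ediam (A : set 'rV[R]_n) x y : A x -> A y ->
  ((enorm (x - y))%:E <= ediam A)%E.
Proof. by move=> Ax Ay; apply: ereal_sup_ubound; right; exists (x, y). Qed.

(** A set of small diameter lies in the cube centred at any of its points. *)
Lemma leb_small (A : set 'rV[R]_n) r : 0 <= r ->
  (forall x y, A x -> A y -> forall i, `|x ord0 i - y ord0 i| <= r) ->
  (leb A <= ((2 * r) ^+ n)%:E)%E.
Proof.
move=> r0 Ar; have [->|/set0P[x Ax]] := eqVneq A set0.
  by rewrite leb_set0 lee_fin exprn_ge0// mulr_ge0.
rewrite -(leb_cube (x - const_mx r)) ?mulr_ge0//; apply: le_leb => y Ay i.
have := Ar _ _ Ay Ax i; rewrite !mxE ler_norml => /andP[h1 h2].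
by apply/andP; split; lra.
Qed.
End EuclideanNorm.

(** * Covering a hyperplane by small pieces *)

Section HyperplaneGrid.
Context {R : realType} {m : nat}.
Implicit Types (a x y : 'rV[R]_m.+1) (c M : R).

(** A hyperplane is a Lipschitz graph over the coordinates other than some
    [i0]. Cutting these [m] coordinates into [N+1] intervals each cuts the
    bounded part of the graph into [(N+1)^m] pieces of size of order
    [1/(N+1)]. *)
Lemma hyperplane_grid a c M : a != 0 -> 0 <= M ->
  exists2 C : R, 0 <= C & forall N : nat,
  exists P : {ffun 'I_m -> 'I_N.+1} -> set 'rV[R]_m.+1,
    (forall x, hyperplane a c x -> (forall i, `|x ord0 i| <= M) -> exists z, P z x) /\
    forall z x y, P z x -> P z y -> forall i, `|x ord0 i - y ord0 i| <= C / N.+1%:R.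
Proof.
move=> a0 M0; have [i0 ai0] : exists i0, a ord0 i0 != 0.
  apply: contrapT => H; case/eqP: a0; apply/rowP => i; rewrite mxE; apply/eqP.
  by rewrite -[_ == _]negbK; apply/negP => ai; apply: H; exists i.
(* One more than the length of the range of a coordinate, so that the rescaled
   coordinate stays strictly below 1 and its integer part below N + 1. *)
pose W := 2 * M + 1; have W0 : 0 < W by rewrite /W; lra.
pose S := (\sum_(j < m) `|a ord0 (lift i0 j)|) / `|a ord0 i0|.
have S0 : 0 <= S by apply: divr_ge0 => //; apply: sumr_ge0 => j _.
exists (W * (1 + S)); first by apply: mulr_ge0; [exact: ltW|exact: addr_ge0].
move=> N; have N0 : 0 < N.+1%:R :> R by rewrite ltr0n.
pose s x (j : 'I_m) : R := (x ord0 (lift i0 j) + M) / W * N.+1%:R.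
exists (fun z : {ffun 'I_m -> 'I_N.+1} => [set x | hyperplane a c x /\
  forall j, (z j)%:R <= s x j < (z j).+1%:R]); split.
  move=> x ax xM.
  have t0 j : 0 <= (x ord0 (lift i0 j) + M) / W < 1.
    have := xM (lift i0 j); rewrite ler_norml => /andP[h1 h2].
    apply/andP; split; first by apply: divr_ge0; [lra|exact: ltW].
    by rewrite ltr_pdivrMr// mul1r /W; lra.
  have s0 j : 0 <= s x j.
    by rewrite mulr_ge0// ?ler0n//; have /andP[] := t0 j.
  have sN j : (Num.truncn (s x j) < N.+1)%N.
    have /andP[h1 _] := truncn_itv (s0 j); rewrite -(ltr_nat R).
    apply: le_lt_trans h1 _; rewrite /s -[ltRHS]mul1r ltr_pM2r//.
    by have /andP[] := t0 j.
  exists [ffun j => Ordinal (sN j)]; split => // j; rewrite ffunE /=.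
  exact: truncn_itv.
move=> z x y [ax xz] [ay yz].
have lft j : `|x ord0 (lift i0 j) - y ord0 (lift i0 j)| <= W / N.+1%:R.
  have E : x ord0 (lift i0 j) - y ord0 (lift i0 j) = (s x j - s y j) * (W / N.+1%:R).
    by rewrite /s; field; rewrite !gt_eqF.
  have q0 : 0 <= W / N.+1%:R by apply: divr_ge0; exact: ltW.
  rewrite E normrM (ger0_norm q0); apply: ler_piMl => //.
  have := xz j; have := yz j; rewrite -!natr1 => /andP[h1 h2] /andP[h3 h4].
  by rewrite ler_norml; apply/andP; split; lra.
move=> i; case: (unliftP i0 i) => [j ->|->].
  apply: le_trans (lft j) _; rewrite ler_pM2r ?invr_gt0//; apply: ler_peMr; [exact: ltW|by rewrite lerDl].
have E : a ord0 i0 * (x ord0 i0 - y ord0 i0) =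
    - \sum_(j < m) a ord0 (lift i0 j) * (x ord0 (lift i0 j) - y ord0 (lift i0 j)).
  have : dot a (x - y) = 0 by rewrite dotBr ax ay subrr.
  rewrite /dot (@bigD1_ord _ _ _ _ i0)//= !mxE => /eqP.
  rewrite addr_eq0 => /eqP ->; congr (- _); apply: eq_bigr => j _; by rewrite !mxE.
have ai0' : 0 < `|a ord0 i0| by rewrite normr_gt0.
rewrite -(ler_pM2l ai0') -normrM E normrN.
apply: le_trans (ler_norm_sum _ _ _) _.
have -> : `|a ord0 i0| * (W * (1 + S) / N.+1%:R) = `|a ord0 i0| * (W / N.+1%:R) +
    (\sum_(j < m) `|a ord0 (lift i0 j)|) * (W / N.+1%:R).
  by rewrite /S; field; rewrite !gt_eqF.
apply: ler_wpDl; first by apply: mulr_ge0 => //; apply: divr_ge0; exact: ltW.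
rewrite mulr_suml; apply: ler_sum => j _.
by rewrite normrM; apply: ler_wpM2l.
Qed.

(** Each of the [(N+1)^m] pieces of the grid has measure of order
    [1/(N+1)^(m+1)], so the bounded part of the hyperplane has measure of
    order [1/(N+1)]. *)
Lemma leb_hyperplane a c : a != 0 -> leb (hyperplane a c) = 0.
Proof.
move=> a0.
suff H (M : nat) : leb (hyperplane a c `&` [set x | forall i, `|x ord0 i| <= M%:R]) = 0.
  apply/eqP; rewrite eq_le leb_ge0 andbT.
  apply: le_trans (le_leb _) _; last first.
    apply: le_trans (leb_sigma_subadditive (fun M : nat => hyperplane a c `&` [set x | forall i, `|x ord0 i| <= M%:R])) _.
    by rewrite eseries0.
  move=> x ax.
  exists (Num.truncn (\sum_i `|x ord0 i|)).+1 => //; split => // i.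
  have s0 : 0 <= \sum_i `|x ord0 i| by apply: sumr_ge0.
  have /andP[_ /ltW] := truncn_itv s0; apply: le_trans.
  by rewrite (bigD1 i)//= lerDl sumr_ge0.
have [C C0 HC] := hyperplane_grid c a0 (ler0n R M).
set A := _ `&` _.
have bound N : (leb A <= ((2 * C) ^+ m.+1 / N.+1%:R)%:E)%E.
  have [P [cov sm]] := HC N.
  apply: (@le_trans _ _ (\sum_z leb (P z))%E).
    by apply: leb_cover => x [ax xM]; exact: cov.
  apply: (@le_trans _ _ (\sum_(z : {ffun 'I_m -> 'I_N.+1}) ((2 * (C / N.+1%:R)) ^+ m.+1)%:E)%E).
    apply: lee_sum => z _; apply: leb_small; last exact: sm.
    by rewrite divr_ge0.
  rewrite sumEFin lee_fin sumr_const card_ffun !card_ord.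
  rewrite -[X in X <= _]mulr_natr natrX le_eqVlt; apply/orP; left; apply/eqP.
  have : N.+1%:R != 0 :> R by rewrite pnatr_eq0.
  rewrite !exprS; move: (N.+1%:R : R) => q q0; rewrite mulrA expr_div_n.
  by field; rewrite q0 expf_neq0.
apply/eqP; rewrite eq_le leb_ge0 andbT; apply/lee_addgt0Pr => e e0; rewrite add0e.
set D := (2 * C) ^+ m.+1 in bound.
apply: le_trans (bound (Num.truncn (D / e))) _; rewrite lee_fin.
have D0 : 0 <= D / e by rewrite divr_ge0 ?exprn_ge0 ?mulr_ge0// ltW.
have /andP[_ /ltW] := truncn_itv D0.
by rewrite ler_pdivrMr// ler_pdivrMr ?ltr0n// mulrC.
Qed.

End HyperplaneGrid.

(** * Hausdorff measure and hyperplanes *)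

Section Hausdorff.
Context {R : realType}.

(** The normalising constant of the Hausdorff measure is positive, and
    finite so that [fine] does not turn it into 0: the unit ball contains a
    cube and is bounded. *)
Lemma unit_ball_volume_gt0 (k : nat) : 0 < unit_ball_volume R k.
Proof.
have hi : (leb [set x : 'rV[R]_k | (enorm x <= 1)%R] <= ((2 * 2) ^+ k)%:E)%E.
  apply: leb_small => // x y x1 y1 i.
  apply: le_trans (ler_normB _ _) _; apply: lerD.
    exact: le_trans (normr_coord_le x i) x1.
  exact: le_trans (normr_coord_le y i) y1.
pose r : R := k.+1%:R^-1.
have r0 : 0 < r by rewrite invr_gt0 ltr0n.
have lo : (((2 * r)%R ^+ k)%:E <= leb [set x : 'rV[R]_k | (enorm x <= 1)%R])%E.
  have r2 : 0 <= 2 * r by rewrite mulr_ge0// ltW.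
  rewrite -(leb_cube (- const_mx r) r2); apply: le_leb => x /= xr.
  apply: le_trans (_ : k%:R * r <= 1).
    apply: enorm_le_coord => i; have := xr i; rewrite !mxE => /andP[h1 h2].
    by rewrite ler_norml; apply/andP; split; lra.
  by rewrite ler_pdivrMr ?ltr0n// mul1r ler_nat.
have p0 : 0 < (2 * r) ^+ k by rewrite exprn_gt0// mulr_gt0.
rewrite /unit_ball_volume fine_gt0//; apply/andP; split.
  by apply: lt_le_trans lo; rewrite lte_fin.
by apply: le_lt_trans hi _; rewrite ltry.
Qed.

Let ck (k : nat) : R := unit_ball_volume R k / 2 ^+ k.
Let ck_gt0 k : 0 < ck k.
Proof. by rewrite divr_gt0 ?unit_ball_volume_gt0// exprn_gt0. Qed.

Lemma hausdorff_pre_ge0 n k delta (A : set 'rV[R]_n) : (0 <= hausdorff_pre k delta A)%E.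
Proof.
apply: le_ereal_inf_tmp => _ [B _ <-]; apply: nneseries_ge0 => i _ _.
by apply: expe_ge0; exact: ediam_ge0.
Qed.

Lemma hausdorff_ge0 n k (A : set 'rV[R]_n) : (0 <= hausdorff k A)%E.
Proof.
apply: mule_ge0; first by rewrite lee_fin; exact/ltW/ck_gt0.
apply: (@le_trans _ _ (hausdorff_pre k 1 A)); first exact: hausdorff_pre_ge0.
by apply: ereal_sup_ubound; exists 1 => /=.
Qed.

(** A covering of the set by pieces of diameters [d_i] is sent to a covering
    by pieces that fit in cubes of side [2 L d_i], of total measure at most
    [(2L)^k] times the sum of the [d_i^k]. *)
Lemma hausdorff0_image n k (A : set 'rV[R]_n) (f : 'rV[R]_n -> 'rV[R]_k) (L : R) :
  0 <= L -> (forall x y i, `|f x ord0 i - f y ord0 i| <= L * enorm (x - y)) ->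
  hausdorff k A = 0%E -> leb (f @` A) = 0%E.
Proof.
move=> L0 fL hA0.
have pre0 : (hausdorff_pre k 1 A <= 0)%E.
  have : (ereal_sup [set hausdorff_pre k delta A | delta in [set t : R | (0 < t)%R]] = 0)%E.
    move/eqP : hA0; rewrite /hausdorff mule_eq0 => /orP[|/eqP//].
    by rewrite eqe gt_eqF// ck_gt0.
  by move=> <-; apply: ereal_sup_ubound; exists 1 => /=.
apply/eqP; rewrite eq_le leb_ge0 andbT; apply/lee_addgt0Pr => e e0; rewrite add0e.
pose c := (2 * L) ^+ k; have c0 : 0 <= c by rewrite exprn_ge0// mulr_ge0.
have c1 : 0 < c + 1 by rewrite ltr_wpDl.
have : (hausdorff_pre k 1 A < (e / (c + 1))%:E)%E.
  by apply: le_lt_trans pre0 _; rewrite lte_fin divr_gt0.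
move=> /ereal_inf_lt[_ [B [B1 AB] <-] Be].
have lebB i : (leb (f @` B i) <= c%:E * (ediam (B i)) ^+ k)%E.
  have dfin : ediam (B i) \is a fin_num.
    by rewrite ge0_fin_numE ?ediam_ge0//; apply: le_lt_trans (B1 i) _; rewrite ltry.
  have d0 : 0 <= fine (ediam (B i)) by rewrite fine_ge0// ediam_ge0.
  rewrite -(fineK dfin) -EFin_expe -EFinM -exprMn -mulrA.
  apply: leb_small; first exact: mulr_ge0.
  move=> _ _ [x Bx <-] [y By <-] j; apply: le_trans (fL x y j) _.
  apply: ler_wpM2l => //; rewrite -lee_fin fineK//; exact: enorm_le_ediam.
apply: (@le_trans _ _ (\sum_(i <oo) leb (f @` B i))%E).
  apply: le_trans (leb_sigma_subadditive _); apply: le_leb => _ [x Ax <-].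
  by have [i _ Bx] := AB _ Ax; exists i => //; exists x.
apply: (@le_trans _ _ (\sum_(i <oo) (c%:E * (ediam (B i)) ^+ k))%E).
  by apply: lee_nneseries => // i _ _; exact: leb_ge0.
rewrite nneseriesZl; last by move=> i _; apply: expe_ge0; exact: ediam_ge0.
apply: le_trans (lee_wpmul2l _ (ltW Be)) _; first by rewrite lee_fin.
rewrite -EFinM lee_fin mulrA ler_pdivrMr// mulrC ler_pM2l//.
by rewrite lerDl.
Qed.

(** The pieces of [hyperplane_grid] number [(N+1)^m] and their diameters are
    of order [1/(N+1)], so the sum of the m-th powers of the diameters stays
    bounded as [N] grows. *)
Lemma hausdorff_hyperplane_fin m (a : 'rV[R]_m.+1) c M (A : set 'rV[R]_m.+1) :
  (0 < m)%N -> a != 0 -> A `<=` hyperplane a c ->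
  (forall x, A x -> forall i, `|x ord0 i| <= M) -> (hausdorff m A < +oo)%E.
Proof.
move=> m0 a0 AH AM.
have [C C0 HC] := hyperplane_grid c a0 (normr_ge0 M).
pose D := m.+1%:R * C.
have D0 : 0 <= D by exact: mulr_ge0.
suff H : (ereal_sup [set hausdorff_pre m delta A | delta in [set t : R | (0 < t)%R]] <= (D ^+ m)%:E)%E.
  rewrite /hausdorff; apply: (@le_lt_trans _ _ ((ck m)%:E * (D ^+ m)%:E)%E).
    by apply: lee_wpmul2l => //; rewrite lee_fin; exact/ltW/ck_gt0.
  by rewrite -EFinM ltry.
apply: ge_ereal_sup => _ [delta /= delta0 <-].
pose N := Num.truncn (D / delta).
have DN : D / N.+1%:R <= delta.
  have /andP[_ /ltW] := truncn_itv (divr_ge0 D0 (ltW delta0)).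
  by rewrite ler_pdivrMr// ler_pdivrMr ?ltr0n// mulrC.
have [P [cov sm]] := HC N.
have eP z : (ediam (P z) <= (D / N.+1%:R)%:E)%E.
  by rewrite /D -mulrA; apply: ediam_le; [exact: divr_ge0|exact: sm].
pose z0 : {ffun 'I_m -> 'I_N.+1} := [ffun=> ord0].
pose T := #|{ffun 'I_m -> 'I_N.+1}|.
(* Coverings are sequences of sets: the grid is listed, then padded with
   empty sets, of diameter 0 and so of null m-th power as m > 0. *)
pose B k := if (k < T)%N then P (nth z0 (enum {ffun 'I_m -> 'I_N.+1}) k) else set0.
pose q := (D / N.+1%:R) ^+ m.
have q0 : 0 <= q by rewrite exprn_ge0// divr_ge0.
have e0 : ediam (set0 : set 'rV[R]_m.+1) = 0%E.
  by apply/eqP; rewrite eq_le ediam_ge0 andbT -[X in (_ <= X%:E)%E](mulr0 m.+1%:R); exact: ediam_le.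
have eB k : ((ediam (B k)) ^+ m <= (if (k < T)%N then q else 0)%:E)%E.
  rewrite /B; case: ifP => _; last by rewrite e0 -EFin_expe expr0n; case: (m) m0.
  set Q := P _; have Qle : (ediam Q <= (D / N.+1%:R)%:E)%E by exact: eP.
  have Qfin : ediam Q \is a fin_num.
    by rewrite ge0_fin_numE ?ediam_ge0//; apply: le_lt_trans Qle _; rewrite ltry.
  move: Qle; rewrite -(fineK Qfin) -EFin_expe !lee_fin => Qle; rewrite /q.
  by apply: lerXn2r; rewrite ?nnegrE ?divr_ge0// fine_ge0// ediam_ge0.
have -> : D ^+ m = q * T%:R.
  by rewrite /q /T card_ffun !card_ord natrX expr_div_n divfK.
apply: le_trans (ereal_inf_lbound _) _; first (exists B; last reflexivity).
  split=> [k|x Ax].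
    rewrite /B; case: ifP => _; last by rewrite e0 lee_fin ltW.
    by apply: le_trans (eP _) _; rewrite lee_fin.
  have [i|z Pz] := cov x (AH _ Ax).
    by apply: le_trans (AM _ Ax i) (ler_norm _).
  exists (index z (enum {ffun 'I_m -> 'I_N.+1})) => //.
  have zT : (index z (enum {ffun 'I_m -> 'I_N.+1}) < T)%N.
    by rewrite /T cardE index_mem mem_enum.
  by rewrite /B zT nth_index// mem_enum.
apply: lime_le.
  by apply: is_cvg_nneseries => k _ _; apply: expe_ge0; exact: ediam_ge0.
near=> K.
apply: (@le_trans _ _ (\sum_(0 <= k < K) (if (k < T)%N then q else 0)%:E)%E).
  by apply: lee_sum => k _.
have E : \sum_(0 <= k < K) (if (k < T)%N then q else 0) = q * (minn K T)%:R.
  elim: (K) => [|k IH]; first by rewrite big_nil min0n mulr0.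
  rewrite big_nat_recr//= IH; case: ltnP => kT.
    by rewrite !(minn_idPl _) ?(ltnW kT)// -natr1 mulrDr mulr1.
  by rewrite !(minn_idPr _) ?addr0// ltnW.
by rewrite sumEFin E lee_fin ler_wpM2l// ler_nat geq_minr.
Unshelve. all: by end_near.
Qed.
End Hausdorff.

(** * Convex open sets, hyperplanes and finite closed covers *)

Section Geometry.
Context {R : realType} {d : nat}.
Implicit Types (x y z a b h : 'rV[R]_d) (A K U : set 'rV[R]_d) (c t : R).

Lemma continuous_line x h : continuous (fun t : R => x + t *: h).
Proof.
move=> t; apply: (@continuousD _ _ _ (fun=> x) (fun t => t *: h)).
  exact: cst_continuous.
exact: (@continuousZr_tmp _ _ _ (fun t : R => t) h t).
Qed.

Lemma near_line x h U : nbhs x U -> \forall t \near (0:R), U (x + t *: h).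
Proof.
move=> Ux; have := @continuous_line x h 0; rewrite /continuous_at scale0r addr0.
by apply.
Qed.

Lemma near_line_pos x h U : nbhs x U -> exists2 t : R, 0 < t <= 1 & U (x + t *: h).
Proof.
move=> Ux; have /nbhs_ballP[e /= e0 eU] := near_line h Ux.
exists (Num.min (e / 2) 1).
  by rewrite lt_min ge_min lexx orbT andbT ltr01 andbT divr_gt0.
apply: eU; rewrite /ball /= sub0r normrN ger0_norm ?le_min ?ler01 ?andbT.
  by rewrite gt_min ltr_pdivrMr// mulr_natr mulr2n ltrDl e0.
by rewrite ltW// divr_gt0.
Qed.

Lemma convex_set_segment A x y t : convex_set A -> A x -> A y -> 0 <= t <= 1 ->
  A (t *: x + (1 - t) *: y).
Proof.
move=> cA Ax Ay /andP[t0 t1].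
by have := cA x y (Itv01 t0 t1) (mem_set Ax) (mem_set Ay); rewrite inE.
Qed.

(** The point of the segment is a convex combination of any point [y'] of
    [K] close to [y] and of a point [f y'] that is close to [x], hence in
    [K]. *)
Lemma convex_open_segment K x y t : convex_set K -> open K -> K x ->
  closure K y -> 0 < t <= 1 -> K (y + t *: (x - y)).
Proof.
move=> cK oK Kx clKy /andP[t0 t1]; set z := y + _.
pose f y' := x + (t^-1 * (1 - t)) *: (y - y').
have fc : {for y, continuous f}.
  apply: (@continuousD _ _ _ (fun=> x)); first exact: cst_continuous.
  apply: (@continuousZl_tmp _ _ _ (fun y' => y - y')).
  by apply: (@continuousB _ _ _ (fun=> y) id); [exact: cst_continuous|exact: cvg_id].
have : nbhs y (f @^-1` K).
  by apply: fc; rewrite /f subrr scaler0 addr0; exact: open_nbhs_nbhs.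
move=> /clKy[y' [Ky' /= Kf]].
have -> : z = t *: f y' + (1 - t) *: y'.
  by rewrite /z /f; apply/rowP => i; rewrite !mxE; field; rewrite gt_eqF.
by apply: convex_set_segment => //; rewrite ltW.
Qed.

Lemma frontier_open K y : open K -> frontier K y -> closure K y /\ ~ K y.
Proof. by move=> /interior_id oK [cK]; rewrite oK. Qed.

Lemma dot_continuous a : continuous (dot a).
Proof.
apply: continuous_fsum => i _; apply: continuous_mul; first exact: continuous_cst.
exact: coord_continuous.
Qed.

Lemma closed_hyperplane a c : closed (hyperplane a c).
Proof.
have -> : hyperplane a c = dot a @^-1` [set c] by [].
by apply: (@closed_comp _ _ (dot a)) => // x _; exact: dot_continuous.
Qed.

(** The two forms being constant on the same small piece of a hyperplane,
    [b] is orthogonal to every vector orthogonal to [a], in particular to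
    its own component orthogonal to [a]. *)
Lemma dot_parallel a b c e U z : a != 0 -> open U -> U z -> dot a z = c ->
  (forall y, U y -> dot a y = c -> dot b y = e) ->
  b = (dot a b / dot a a) *: a.
Proof.
move=> a0 oU Uz az Ub; set k := _ / _.
have ah : dot a (b - k *: a) = 0.
  by rewrite dotBr dotZr /k divfK ?subrr// dot_eq0.
have [t /andP[t0 _] Ut] := near_line_pos (b - k *: a) (open_nbhs_nbhs (conj oU Uz)).
have bh : dot b (b - k *: a) = 0.
  have : dot b (z + t *: (b - k *: a)) = e.
    by apply: Ub => //; rewrite (dotDr a z) dotZr ah mulr0 addr0.
  rewrite (dotDr b z) dotZr (Ub _ Uz az) => /eqP.
  by rewrite -[X in _ == X]addr0 (inj_eq (addrI _)) mulf_eq0 gt_eqF//= => /eqP.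
by apply/eqP; rewrite -subr_eq0 -dot_eq0 dotBl bh dotZl ah mulr0 subrr.
Qed.

(** A finite form of Baire's theorem: if the first closed set does not
    contain [U `&` H], removing it from [U] leaves a nonempty relatively
    open set covered by the others. *)
Lemma finite_cover_interior (I : eqType) (s : seq I) (F : I -> set 'rV[R]_d) H U :
  (forall i, closed (F i)) -> open U -> U `&` H !=set0 ->
  U `&` H `<=` [set x | exists2 i, i \in s & F i x] ->
  exists i V, [/\ i \in s, open V, V `<=` U, V `&` H !=set0 & V `&` H `<=` F i].
Proof.
move=> cF; elim: s U => [|i s IH] U oU U0 cov.
  by have [x /cov[i]] := U0.
have [Fi|] := pselect (U `&` H `<=` F i).
  by exists i, U; split => //; exact: mem_head.
move=> /existsNP[x /not_implyP[[Ux Hx] Fix]].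
have [|||j [V [js oV VU V0 VF]]] := IH (U `&` ~` F i).
- by apply: openI => //; exact: closed_openC.
- by exists x.
- move=> y [[Uy nFy] Hy]; have [//|j] := cov y.
  by rewrite inE => /orP[/eqP ->|js Fj] //; exists j.
exists j, V; split => //; first by rewrite inE js orbT.
by move=> y /VU[].
Qed.

End Geometry.

Lemma connected_closed_meet (T : topologicalType) (A F G : set T) :
  connected A -> closed F -> closed G -> A `<=` F `|` G ->
  A `&` F !=set0 -> A `&` G !=set0 -> exists x, [/\ A x, F x & G x].
Proof.
move=> cA cF cG AFG A0 [x [Ax Gx]]; apply: contrapT => N.
have E : A `&` F = A.
  apply: cA => //; last by exists F.
  exists (~` G); first exact: closed_openC.
  apply/seteqP; split => y [Ay Fy]; split => //.
    by move=> Gy; apply: N; exists y.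
  by have [] := AFG _ Ay.
by apply: N; exists x; split => //; move: Ax; rewrite -{1}E => -[].
Qed.

(** * Projections along a direction *)

Section Shadow.
Context {R : realType} {m : nat}.
Implicit Types (a w x y z : 'rV[R]_m.+1) (A U : set 'rV[R]_m.+1) (c : R).

Lemma nonzero_coord a : a != 0 -> exists i, a ord0 i != 0.
Proof.
move=> a0; apply: contrapT => H; case/eqP: a0; apply/rowP => i; rewrite mxE; apply/eqP.
by rewrite -[_ == _]negbK; apply/negP => ai; apply: H; exists i.
Qed.

(** The projection along [w] onto the hyperplane where coordinate [i0]
    vanishes. *)
Definition shadow (i0 : 'I_m.+1) w x : 'rV[R]_m :=
  \row_j (x ord0 (lift i0 j) - w ord0 (lift i0 j) / w ord0 i0 * x ord0 i0).

Lemma shadow_lipschitz i0 w : exists2 L : R, 0 <= L &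
  forall x y j, `|shadow i0 w x ord0 j - shadow i0 w y ord0 j| <= L * enorm (x - y).
Proof.
pose q (j : 'I_m) := `|w ord0 (lift i0 j) / w ord0 i0|.
have q0 : 0 <= \sum_j q j by apply: sumr_ge0 => j _; exact: normr_ge0.
exists (1 + \sum_j q j); first by rewrite addr_ge0.
move=> x y j; rewrite !mxE.
have -> : x ord0 (lift i0 j) - w ord0 (lift i0 j) / w ord0 i0 * x ord0 i0 -
   (y ord0 (lift i0 j) - w ord0 (lift i0 j) / w ord0 i0 * y ord0 i0) =
   (x - y) ord0 (lift i0 j) - w ord0 (lift i0 j) / w ord0 i0 * (x - y) ord0 i0.
  by rewrite !mxE; ring.
have e0 : 0 <= enorm (x - y) by exact: sqrtr_ge0.
apply: le_trans (ler_normB _ _) _; rewrite mulrDl mul1r; apply: lerD.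
  exact: normr_coord_le.
rewrite normrM; apply: le_trans (ler_wpM2l (normr_ge0 _) (normr_coord_le _ _)) _.
apply: ler_wpM2r => //; rewrite (bigD1 j)//= lerDl.
by apply: sumr_ge0 => k _; exact: normr_ge0.
Qed.

Lemma shadow_line i0 w x t : w ord0 i0 != 0 -> shadow i0 w (x + t *: w) = shadow i0 w x.
Proof. by move=> w0; apply/rowP => j; rewrite !mxE; field. Qed.

(** A vector whose coordinate [i0] is 0: adding it to a point translates the
    shadow of the point. *)
Definition lift_row (i0 : 'I_m.+1) (u : 'rV[R]_m) : 'rV[R]_m.+1 :=
  \row_i (if unlift i0 i is Some j then u ord0 j else 0).

Lemma shadow_lift_row i0 w x u : shadow i0 w (x + lift_row i0 u) = shadow i0 w x + u.
Proof. by apply/rowP => j; rewrite !mxE liftK unlift_none; ring. Qed.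

Lemma near_lift_row i0 x U : nbhs x U -> exists2 e : R, 0 < e &
  forall u : 'rV[R]_m, (forall j, `|u ord0 j| <= e) -> U (x + lift_row i0 u).
Proof.
move=> /nbhs_ballP[e /= e0 eU]; exists (e / 2); first by rewrite divr_gt0.
move=> u ue; apply: eU; split => // k i; rewrite (ord1 k : k = ord0) /ball /=.
rewrite !mxE opprD addrA subrr add0r normrN.
case: unliftP => [j _|_]; last by rewrite normr0.
by apply: le_lt_trans (ue j) _; rewrite ltr_pdivrMr// mulr_natr mulr2n ltrDl.
Qed.

Lemma leb_cube_neq0 n (v : 'rV[R]_n) (A : set 'rV[R]_n) (e : R) : 0 < e ->
  (forall u : 'rV[R]_n, (forall j, `|u ord0 j| <= e) -> A (v + u)) -> leb A <> 0%E.
Proof.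
move=> e0 Ae A0; have : (leb (cube (v - const_mx e) (2 * e)) <= 0)%E.
  rewrite -A0; apply: le_leb => x xe.
  rewrite -[x](subrK v) addrC; apply: Ae => j; have := xe j.
  by rewrite !mxE ler_norml => /andP[h1 h2]; apply/andP; split; lra.
have r2 : 0 <= 2 * e by rewrite mulr_ge0// ltW.
rewrite leb_cube// lee_fin leNgt => /negP; apply.
by rewrite exprn_gt0// mulr_gt0.
Qed.

(** The hyperplane is the graph of a continuous function over the
    coordinates other than some [i0]; the projection of a relatively open
    piece of it on these coordinates contains a cube, which is not a null
    set. *)
Lemma hausdorff_hyperplane_neq0 a c U A : a != 0 -> open U ->
  U `&` hyperplane a c !=set0 -> U `&` hyperplane a c `<=` A -> hausdorff m A <> 0%E.
Proof.
move=> a0 oU [z [Uz az]] UA hA0.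
have [i0 ai0] := nonzero_coord a0.
pose w : 'rV[R]_m.+1 := delta_mx ord0 i0.
have w0 : w ord0 i0 != 0 by rewrite mxE !eqxx oner_neq0.
have [L L0 Ll] := shadow_lipschitz i0 w.
have null := hausdorff0_image L0 Ll hA0.
(* The graph: the correction along w brings the point back to the hyperplane. *)
pose g (u : 'rV[R]_m) := z + lift_row i0 u - (dot a (lift_row i0 u) / a ord0 i0) *: w.
have gc : continuous g.
  have lc : continuous (lift_row i0).
    move=> u A0 /nbhs_ballP[e /= e0 eA]; apply/nbhs_ballP; exists e => //= v [_ uv].
    apply: eA; split => // k i; rewrite !mxE; case: unliftP => [j _|_]; last exact: ballxx.
    by rewrite -(ord1 k : k = ord0); exact: uv.
  move=> u; apply: (@continuousB _ _ _ (fun u => z + lift_row i0 u)).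
    by apply: (@continuousD _ _ _ (fun=> z)); [exact: cst_continuous|exact: lc].
  apply: (@continuousZr_tmp _ _ _ (fun u => dot a (lift_row i0 u) / a ord0 i0)).
  apply: (@continuousM _ _ (fun u => dot a (lift_row i0 u)) (fun=> _)); last exact: cst_continuous.
  exact: (@continuous_comp _ _ _ (lift_row i0) (dot a) u (lc u) (@dot_continuous _ _ _ _)).
have g0 : g 0 = z.
  have l0 : lift_row i0 (0 : 'rV[R]_m) = 0.
    by apply/rowP => i; rewrite !mxE; case: unlift => // j; rewrite mxE.
  have a00 : dot a 0 = 0 by rewrite -(scale0r (0 : 'rV[R]_m.+1)) dotZr mul0r.
  by rewrite /g l0 a00 mul0r scale0r subr0 addr0.
have aw : dot a w = a ord0 i0.
  rewrite /dot (bigD1 i0)//= mxE !eqxx mulr1 big1 ?addr0// => i /negbTE ii0.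
  by rewrite mxE ii0 andbF mulr0.
have ag u : hyperplane a c (g u).
  by rewrite /hyperplane /= /g dotBr dotZr aw divfK// dotDr az addrK.
have : nbhs (0 : 'rV[R]_m) (g @^-1` U) by apply: gc; rewrite g0; exact: open_nbhs_nbhs.
move=> /nbhs_ballP[e /= e0 eU].
have e2 : 0 < e / 2 by rewrite divr_gt0.
apply: (@leb_cube_neq0 m (shadow i0 w z) _ (e / 2) e2 _ null) => u ue.
exists (g u).
  apply: UA; split => //; apply: eU; split => // k j.
  rewrite (ord1 k : k = ord0) /ball /= mxE sub0r normrN.
  by apply: le_lt_trans (ue j) _; rewrite ltr_pdivrMr// mulr_natr mulr2n ltrDl.
by rewrite /g -scaleNr shadow_line// shadow_lift_row.
Qed.

End Shadow.

(** * Position of two cells with respect to their interface *)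

Section MeshGeometry.
Context {R : realType} {m : nat}.
Variables (Omega : set 'rV[R]_m.+1) (M : mesh R m.+1).
Hypothesis openO : open Omega.
Hypothesis hM : admissible Omega M.
Implicit Types (K L : cell M) (s : edge M) (a x y z : 'rV[R]_m.+1) (c t : R).

Lemma cell_eq K L x : cell_set K x -> cell_set L x -> K = L.
Proof.
move=> Kx Lx; apply: contrapT => KL.
by move/seteqP : (cell_disjoint hM KL) => [/(_ x) H _]; exact: H.
Qed.

(** A cell is open, so it would meet the cell whose closure it meets. *)
Lemma cell_closure_eq K L x : cell_set K x -> closure (cell_set L) x -> K = L.
Proof.
move=> Kx clLx; have [y [Ly Ky]] := clLx _ (open_nbhs_nbhs (conj (@cell_open _ _ _ _ hM K) Kx)).
exact: cell_eq Ky Ly.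
Qed.

Lemma cell_segment K x y t : cell_set K x -> closure (cell_set K) y ->
  0 < t <= 1 -> cell_set K (y + t *: (x - y)).
Proof. exact: convex_open_segment (@cell_convex _ _ _ _ hM K) (@cell_open _ _ _ _ hM K). Qed.

Lemma edge_of_closure K s y : edge_of K s -> edge_set s y ->
  closure (cell_set K) y /\ ~ cell_set K y.
Proof. by move=> Ks /Ks; apply: frontier_open; exact: (cell_open hM). Qed.

Definition flat s a c (U : set 'rV[R]_m.+1) :=
  [/\ a != 0, open U & edge_set s = U `&` hyperplane a c].

Lemma flat_ex s : exists a c U, flat s a c U.
Proof. by have [a [c [U H]]] := edge_flat hM s; exists a, c, U. Qed.

Lemma flat_in s a c U y : flat s a c U -> edge_set s y -> U y /\ dot a y = c.
Proof. by move=> [_ _ ->]. Qed.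

(** Otherwise the segment from a point of [K] in the plane to a point of the
    edge would run inside the edge near its end, while all its points but
    the end lie in [K]. *)
Lemma cell_off_plane K s a c U x : flat s a c U -> edge_of K s ->
  cell_set K x -> dot a x <> c.
Proof.
move=> sf Ks Kx ax; have [y sy] := edge_nonempty hM s.
have [Uy ay] := flat_in sf sy; have [a0 oU sE] := sf.
have [clKy _] := edge_of_closure Ks sy.
have [t t01 Ut] := near_line_pos (x - y) (open_nbhs_nbhs (conj oU Uy)).
have : edge_set s (y + t *: (x - y)).
  by rewrite sE; split => //; rewrite /hyperplane /= dotDr dotZr dotBr ax ay subrr mulr0 addr0.
by move=> /(edge_of_closure Ks)[_]; apply; exact: cell_segment.
Qed.

(** A convex set that avoids a plane lies on one side of it. *)
Lemma cell_side K s a c U x x' : flat s a c U -> edge_of K s ->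
  cell_set K x -> cell_set K x' -> 0 < (dot a x - c) * (dot a x' - c).
Proof.
move=> sf Ks Kx Kx'.
wlog le : x x' Kx Kx' / dot a x <= dot a x'.
  move=> H; have [/H|/ltW /H] := leP (dot a x) (dot a x'); first exact.
  by rewrite mulrC; exact.
have := cell_off_plane sf Ks Kx; have := cell_off_plane sf Ks Kx'.
move=> /eqP xc' /eqP xc; rewrite lt_def mulf_neq0 ?subr_eq0//= leNgt; apply/negP => neg.
have lt1 : dot a x < c.
  rewrite ltNge; apply/negP => cx; move: neg; apply/negP; rewrite -leNgt.
  by apply: mulr_ge0; lra.
have lt2 : c < dot a x'.
  rewrite ltNge; apply/negP => cx; move: neg; apply/negP; rewrite -leNgt.
  by apply: mulr_le0; lra.
pose D := dot a x' - dot a x; have D0 : 0 < D by rewrite /D; lra.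
pose t := (dot a x' - c) / D.
have t01 : 0 <= t <= 1.
  apply/andP; split; first by apply: divr_ge0; [lra|exact: ltW].
  by rewrite ler_pdivrMr// mul1r /D; lra.
have := convex_set_segment (@cell_convex _ _ _ _ hM K) Kx Kx' t01.
move=> /(cell_off_plane sf Ks); apply; rewrite dotDr !dotZr /t /D; field.
by rewrite gt_eqF// -/D.
Qed.

Lemma separates_sym s K L : separates s K L -> separates s L K.
Proof. by move=> [KL E]; split; [move=> /esym|rewrite setIC]. Qed.

Lemma separates_edge_of s K L : separates s K L -> edge_of K s.
Proof.
move=> [KL E] y sy; have : closure (edge_set s) y by exact: subset_closure.
rewrite -E => -[clK clL]; split => //; rewrite (interior_id _).1; last exact: (cell_open hM).
by move=> Ky; apply: KL; exact: cell_closure_eq Ky clL.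
Qed.

(** The foot [y] of the perpendicular lies strictly between the centres: if
    it did not, one centre would lie on the segment from [y] to the other,
    thus in the cell of the other. *)
Lemma separates_foot s K L a c U : separates s K L -> flat s a c U ->
  exists y t k, [/\ edge_set s y, 0 < t < 1, k != 0,
    centre K = y - (t * k) *: a & centre L = y + ((1 - t) * k) *: a].
Proof.
move=> sKL sf; have [[t sy] orth] := interface_orth hM sKL.
set w := centre L - centre K in sy orth; set y := centre K + _ in sy.
have [a0 oU sE] := sf; have [Uy ay] := flat_in sf sy.
have wE : w = (dot a w / dot a a) *: a.
  apply: (dot_parallel (e := dot w y) a0 oU Uy ay) => z Uz az.
  have sz : edge_set s z by rewrite sE; split.
  by apply/eqP; rewrite -subr_eq0 -dotBr; apply/eqP; exact: orth.
set k := _ / _ in wE.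
have KL : K <> L by case: sKL.
have w0 : w != 0.
  apply/eqP => /eqP; rewrite subr_eq0 => /eqP E; apply: KL.
  by apply: (cell_eq (centre_in hM K)); rewrite -E; exact: (centre_in hM).
have k0 : k != 0 by apply: contra w0 => /eqP k0; rewrite wE k0 scale0r.
have [clK nK] := edge_of_closure (separates_edge_of sKL) sy.
have [clL nL] := edge_of_closure (separates_edge_of (separates_sym sKL)) sy.
have Kc := centre_in hM K; have Lc := centre_in hM L.
have yL : centre L = y + (1 - t) *: w.
  by rewrite /y /w; apply/rowP => i; rewrite !mxE; ring.
have yK : centre K = y - t *: w by rewrite /y addrK.
have yt0 : t = 0 -> y = centre K by move=> t0; rewrite /y t0 scale0r addr0.
have yt1 : t = 1 -> y = centre L by move=> t1; rewrite yL t1 subrr scale0r addr0.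
clearbody k y w.
exists y, t, k; split => //; last 2 first.
- by rewrite -scalerA -wE.
- by rewrite -scalerA -wE.
apply/andP; split.
- rewrite lt_neqAle; apply/andP; split.
    by apply/eqP => t0; apply: nK; rewrite yt0.
  rewrite leNgt; apply/negP => t0; apply: KL.
  have t1 : 0 < 1 - t by lra.
  have := cell_segment Lc clL (t := - t / (1 - t)).
  rewrite divr_gt0 ?oppr_gt0//= ler_pdivrMr// mul1r => /(_ _) /=.
  have -> : y + (- t / (1 - t)) *: (centre L - y) = centre K.
    by rewrite yL yK; apply/rowP => i; rewrite !mxE; field; rewrite gt_eqF.
  by move=> H; apply: cell_eq Kc (H _); lra.
- rewrite lt_neqAle; apply/andP; split.
    by apply/eqP => t1; apply: nL; rewrite yt1.
  rewrite leNgt; apply/negP => t1; apply: KL.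
  have t0 : 0 < t by lra.
  have := cell_segment Kc clK (t := (t - 1) / t).
  rewrite divr_gt0 ?subr_gt0//= ler_pdivrMr// mul1r => /(_ _) /=.
  have -> : y + ((t - 1) / t) *: (centre K - y) = centre L.
    by rewrite yL yK; apply/rowP => i; rewrite !mxE; field; rewrite gt_eqF.
  by move=> H; apply: (cell_eq (H _) Lc); lra.
Qed.

Lemma separates_opposite s K L a c U x x' : separates s K L -> flat s a c U ->
  cell_set K x -> cell_set L x' -> (dot a x - c) * (dot a x' - c) < 0.
Proof.
move=> sKL sf Kx Lx'.
have [y [t [k [sy /andP[t0 t1] k0 Kc Lc]]]] := separates_foot sKL sf.
have [_ ay] := flat_in sf sy; have [a0 _ _] := sf.
have h1 := cell_side sf (separates_edge_of sKL) (centre_in hM K) Kx.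
have h2 := cell_side sf (separates_edge_of (separates_sym sKL)) (centre_in hM L) Lx'.
move: h1 h2; rewrite Kc Lc dotBr dotDr !dotZr ay.
rewrite addrC addKr [c + _]addrC addrK => h1 h2.
have p0 : 0 < (t * (1 - t)) * (k * dot a a) ^+ 2.
  apply: mulr_gt0; first by apply: mulr_gt0 => //; lra.
  by rewrite exprn_even_gt0//= mulf_neq0// dot_eq0.
rewrite -(@pmulr_rlt0 _ _ _ p0) -oppr_gt0; apply: lt_le_trans (mulr_gt0 h1 h2) _.
by rewrite le_eqVlt; apply/orP; left; apply/eqP; ring.
Qed.

(** The centres of [K] and [K'] lie on the same normal through the centre of
    [L], and on the same side of the edge: the one that is closer to the
    edge lies on the segment from the foot to the other, thus in the cell of
    the other. *)
Lemma separates_unique s K K' L : separates s K L -> separates s K' L -> K = K'.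
Proof.
move=> sK sK'; have [a [c [U sf]]] := flat_ex s; have [a0 _ _] := sf.
have [y [t [k [sy /andP[t0 t1] k0 Kc Lc]]]] := separates_foot sK sf.
have [y' [t' [k' [sy' /andP[t0' t1'] k0' Kc' Lc']]]] := separates_foot sK' sf.
have [_ ay] := flat_in sf sy; have [_ ay'] := flat_in sf sy'.
have aa := dot_gt0 a0.
have kk : (1 - t) * k = (1 - t') * k'.
  have : dot a (centre L) - c = dot a (centre L) - c by [].
  rewrite {1}Lc Lc' !dotDr !dotZr ay ay' ![c + _]addrC !addrK.
  by apply: mulIf; rewrite gt_eqF.
have yy : y = y'.
  have : y + ((1 - t) * k) *: a = y' + ((1 - t') * k') *: a by rewrite -Lc -Lc'.
  by rewrite kk => /addIr.
(* Two centres on the same ray from y; the ratio compares their distances to y. *)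
have key (J J' : cell M) p p' : centre J = y - p *: a -> centre J' = y - p' *: a ->
    closure (cell_set J') y -> p' != 0 -> 0 < p / p' <= 1 -> J = J'.
  move=> Jc Jc' clJ' p0 pp; have := cell_segment (centre_in hM J') clJ' pp.
  have -> : y + (p / p') *: (centre J' - y) = centre J.
    by rewrite Jc Jc'; apply/rowP => i; rewrite !mxE; field.
  exact: (cell_eq (centre_in hM J)).
have [clK _] := edge_of_closure (separates_edge_of sK) sy.
have [clK' _] := edge_of_closure (separates_edge_of sK') sy.
have tk0 : t * k != 0 by rewrite mulf_neq0// gt_eqF.
have tk0' : t' * k' != 0 by rewrite mulf_neq0// gt_eqF.
rewrite -yy in Kc'.
have r0 : 0 < t * k / (t' * k').
  have -> : t * k / (t' * k') = (t * (1 - t')) / (t' * (1 - t)).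
    have -> : k = (1 - t') * k' / (1 - t) by rewrite -kk; field; lra.
    by field; rewrite k0' /=; apply/andP; split; lra.
  by apply: divr_gt0; apply: mulr_gt0 => //; lra.
have [le|lt] := leP (t * k / (t' * k')) 1.
  by apply: (key _ _ _ _ Kc Kc') => //; rewrite r0.
apply/esym; apply: (key _ _ _ _ Kc' Kc) => //.
by rewrite -invf_div invr_gt0 r0 invf_le1// ltW.
Qed.

(** The unit vectors among which [normal] makes its choice. *)
Definition normals K s : set 'rV[R]_m.+1 := [set a | [/\ enorm a = 1, orth_to a (edge_set s) &
    forall x y, cell_set K x -> edge_set s y -> dot a (x - y) < 0]].

Lemma normals_scale K s n a c U : normals K s n -> flat s a c U ->
  exists k, n = k *: a.
Proof.
move=> [_ orth _] sf; have [y sy] := edge_nonempty hM s.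
have [Uy ay] := flat_in sf sy; have [a0 oU sE] := sf.
exists (dot a n / dot a a); apply: (dot_parallel (e := dot n y) a0 oU Uy ay) => z Uz az.
have sz : edge_set s z by rewrite sE; split.
by apply/eqP; rewrite -subr_eq0 -dotBr; apply/eqP; exact: orth.
Qed.

(** The normals are collinear to the vector [a] of the plane, of the same
    length, and on the same side. *)
Lemma normals_unique K s n n' : normals K s n -> normals K s n' -> n = n'.
Proof.
move=> Nn Nn'; have [a [c [U sf]]] := flat_ex s; have [a0 _ _] := sf.
have [k nE] := normals_scale Nn sf; have [k' nE'] := normals_scale Nn' sf.
have [e1 _ neg] := Nn; have [e1' _ neg'] := Nn'.
have [y sy] := edge_nonempty hM s.
have := neg _ _ (centre_in hM K) sy; have := neg' _ _ (centre_in hM K) sy.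
move: e1 e1'; rewrite nE nE' !dotZl /enorm !dotZl !dotZr.
set q := dot a a; set p := dot a _ => e1 e1' h h'.
have q0 : 0 < q by exact: dot_gt0.
have sq : k ^+ 2 = k' ^+ 2.
  have nn (r : R) : 0 <= r * (r * q).
    by rewrite mulrA -expr2; apply: mulr_ge0; [exact: sqr_ge0|exact: ltW].
  have := congr1 (fun r : R => r ^+ 2) (etrans e1 (esym e1')).
  rewrite !sqr_sqrtr//.
  by rewrite !mulrA -!expr2 => /mulIf; apply; rewrite gt_eqF.
move/eqP: sq; rewrite eqf_sqr => /orP[/eqP ->//|/eqP kk].
by move: h h'; rewrite kk mulNr => h; rewrite oppr_lt0 ltNge ltW.
Qed.

Lemma normals_ex K s : edge_of K s -> exists n, normals K s n.
Proof.
move=> Ks; have [a [c [U sf]]] := flat_ex s; have [a0 oU sE] := sf.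
have Kc := centre_in hM K; have off := cell_off_plane sf Ks Kc.
pose e : R := if dot a (centre K) < c then 1 else -1.
have e2 : e * e = 1 by rewrite /e; case: ifP => _; rewrite ?mulr1// mulrNN mulr1.
exists ((e / enorm a) *: a); split.
- rewrite /enorm dotZl dotZr mulrA -expr2 expr_div_n sqr_sqrtr ?dot_ge0//.
  by rewrite expr2 e2 mul1r mulVf ?sqrtr1// dot_eq0.
- move=> y z sy sz; have [_ ay] := flat_in sf sy; have [_ az] := flat_in sf sz.
  by rewrite dotZl dotBr ay az subrr mulr0.
- move=> x y Kx sy; have [_ ay] := flat_in sf sy.
  rewrite dotZl dotBr ay mulrAC pmulr_llt0 ?invr_gt0 ?enorm_gt0//.
  have := cell_side sf Ks Kc Kx; rewrite /e; case: (ltP (dot a (centre K)) c) => [lt|ge].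
    have lt0 : dot a (centre K) - c < 0 by rewrite subr_lt0.
    by rewrite nmulr_rgt0// mul1r.
  have gt : 0 < dot a (centre K) - c.
    by rewrite subr_gt0 lt_neqAle ge andbT; apply/eqP => /esym.
  by rewrite pmulr_rgt0// mulN1r oppr_lt0.
Qed.

Lemma normal_normals K s : edge_of K s -> normals K s (normal K s).
Proof. by move=> /normals_ex[n Nn]; exact: (xgetI 0 Nn). Qed.

(** The opposite of the outward normal of [K] points outwards from [L],
    because [L] lies on the other side of the edge. *)
Lemma normal_opp s K L : separates s K L -> normal L s = - normal K s.
Proof.
move=> sKL; have Ks := separates_edge_of sKL.
have Nn := normal_normals Ks; have [e1 orth neg] := Nn.
have Ls := separates_edge_of (separates_sym sKL).
apply: (normals_unique (normal_normals Ls)); split.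
- by rewrite enormN.
- by move=> y z sy sz; rewrite dotNl orth// oppr0.
- move=> x y Lx sy; have [a [c [U sf]]] := flat_ex s.
  have [k nE] := normals_scale Nn sf; have [_ ay] := flat_in sf sy.
  have := neg _ _ (centre_in hM K) sy.
  have := separates_opposite sKL sf (centre_in hM K) Lx.
  rewrite nE -scaleNr !dotZl !dotBr ay; set p := dot a x - c; set q := dot a _ - c.
  move=> qp kq; rewrite mulNr oppr_lt0 ltNge; apply/negP => kp.
  have : 0 <= k * q * (k * p) by apply: mulr_le0 => //; exact: ltW.
  rewrite mulrACA -expr2 leNgt => /negP; apply; rewrite pmulr_rlt0// exprn_even_gt0//=.
  by apply/eqP => k0; move: kq; rewrite k0 mul0r ltxx.
Qed.

End MeshGeometry.

(** * The graph of the mesh *)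

Section MeshGraph.
Context {R : realType} {m : nat}.
Variables (Omega : set 'rV[R]_m.+1) (M : mesh R m.+1).
Hypothesis openO : open Omega.
Hypothesis hM : admissible Omega M.
Implicit Types (K L : cell M) (s : edge M) (a x y z : 'rV[R]_m.+1) (c t : R).

Lemma edgesP K s : reflect (edge_of K s) (s \in edges K).
Proof. by rewrite inE; apply: (iffP (@asboolP _)). Qed.

Lemma interior_edgesP K s :
  reflect (edge_of K s /\ interior_edge Omega s) (s \in interior_edges Omega K).
Proof. by rewrite finset.in_set; apply: (iffP andP) => -[/edgesP h1 h2]. Qed.

Lemma interior_edgeP s : interior_edge Omega s <-> exists y, edge_set s y /\ Omega y.
Proof.
split => [/asboolP/existsNP[y /not_implyP[sy ny]]|[y [sy Oy]]].
  exists y; split => //; apply: contrapT => nO; apply: ny.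
  by split; [exact: edge_sub sy|rewrite (interior_id _).1].
by apply/asboolP => /(_ _ sy)[_]; rewrite (interior_id _).1.
Qed.

(** Just beyond [y], points belong to Omega and to no point of the closure
    of [K], which stays on its side of the edge; so they belong to closures
    of other cells, and so does [y] in the limit. *)
Lemma far_side K s a c U y : flat s a c U -> edge_of K s -> edge_set s y -> Omega y ->
  exists2 L, L <> K & closure (cell_set L) y.
Proof.
move=> sf Ks sy Oy; apply: contrapT => H.
have [Uy ay] := flat_in sf sy; have [a0 oU sE] := sf.
have Kc := centre_in hM K.
have off : dot a (centre K) <> c := cell_off_plane hM sf Ks Kc.
(* The sign of e makes e *: a point away from K. *)
pose e := c - dot a (centre K).
have e0 : e != 0 by rewrite subr_eq0; apply/eqP => /esym.
pose W := Omega `&` [set z | forall L, L <> K -> ~ closure (cell_set L) z].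
have Wy : nbhs y W.
  apply: filterI; first exact: open_nbhs_nbhs.
  apply: (@filter_forall _ (cell M) (fun L z => L <> K -> ~ closure (cell_set L) z) (nbhs y)) => L; have [LK|LK] := pselect (L = K).
    by apply: filterE => z /(_ LK).
  apply: (@filterS _ _ _ (~` closure (cell_set L))) => [z nz _ //|].
  apply: open_nbhs_nbhs; split; first exact/closed_openC/closed_closure.
  by move=> Ly; apply: H; exists L.
have [t /andP[t0 _] [Ot Ht]] := near_line_pos (e *: a) Wy.
have : closure Omega (y + t *: (e *: a)) by exact: subset_closure.
rewrite (cell_cover hM) => -[L _ clL].
have [LK|LK] := pselect (L = K); last exact: Ht LK clL.
rewrite {}LK in clL.
have oS : open [set z | 0 < e * (dot a z - c)].
  apply: (@open_comp _ _ (fun z => e * (dot a z - c)) [set r | 0 < r]); last exact: open_gt.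
  move=> z _; apply: (@continuousM _ _ (fun=> e) (fun z => dot a z - c)).
    exact: cst_continuous.
  by apply: (@continuousB _ R^o _ (dot a) (fun=> c)); [exact: dot_continuous|exact: cst_continuous].
have [] := clL [set z | 0 < e * (dot a z - c)].
  apply: open_nbhs_nbhs; split => //=.
  rewrite dotDr !dotZr ay addrC addKr.
  rewrite mulrCA; apply: mulr_gt0 => //; rewrite mulrA; apply: mulr_gt0; last exact: dot_gt0.
  by rewrite -expr2 exprn_even_gt0.
move=> z [Kz /=]; have := cell_side hM sf Ks Kc Kz.
by rewrite -[dot a _ - c]opprB -/e mulNr oppr_gt0 => /ltW; rewrite leNgt => /negP.
Qed.

(** By [far_side], near an interior point the edge is covered by the
    closures of finitely many cells other than [K]; one of them contains a
    relatively open piece of the edge, so it shares with [K] a set of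
    positive (d-1)-dimensional measure. By admissibility it shares the
    closure of an edge, which lies in the same plane and meets [s], and so
    is [s]. *)
Lemma neighbour_ex K s : s \in interior_edges Omega K -> exists L, separates s K L.
Proof.
move=> /interior_edgesP[Ks /interior_edgeP[y [sy Oy]]].
have [a [c [U sf]]] := flat_ex hM s; have [a0 oU sE] := sf.
have [Uy ay] := flat_in sf sy.
pose F L := if L == K then set0 else closure (cell_set L).
have cF L : closed (F L).
  by rewrite /F; case: ifP => _; [exact: closed0|exact: closed_closure].
have [||z [[Uz Oz] az]|L [V [_ oV VU V0 VF]]] :=
    @finite_cover_interior _ _ _ (index_enum (cell M)) F (hyperplane a c) (U `&` Omega) cF.
- exact: openI.
- by exists y.
- have sz : edge_set s z by rewrite sE.
  have [L /eqP LK Lz] := far_side sf Ks sz Oz.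
  by exists L; rewrite ?mem_index_enum// /F (negbTE LK).
have LK : L != K.
  apply/eqP => LK; have [x VHx] := V0; have := VF _ VHx.
  by rewrite /F LK eqxx.
rewrite /F (negbTE LK) in VF.
have VK : V `&` hyperplane a c `<=` closure (cell_set K) `&` closure (cell_set L).
  move=> x VHx; split; last exact: VF.
  have [Vx ax] := VHx; have [Ux _] := VU _ Vx.
  have sx : edge_set s x by rewrite sE.
  by have [] := edge_of_closure hM Ks sx.
have nz := hausdorff_hyperplane_neq0 a0 oV V0 VK.
have KL : K <> L by move/eqP : LK => LK /esym.
have [//|[s' s'KL]] := cell_interface hM KL.
(* The plane of s' contains a relatively open piece of that of s, so they agree. *)
suff -> : s = s' by exists L.
have [_ E] := s'KL; rewrite E in VK.
have [a' [c' [U' sf']]] := flat_ex hM s'; have [a0' oU' sE'] := sf'.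
have s'H : closure (edge_set s') `<=` hyperplane a' c'.
  rewrite [X in _ `<=` X](closure_id _).1; last exact: closed_hyperplane.
  by apply: closure_subset; rewrite sE'; exact: subIsetr.
have [x [Vx ax]] := V0.
have a'E := dot_parallel (e := c') a0 oV Vx ax (fun z Vz az => s'H _ (VK _ (conj Vz az))).
set k := _ / _ in a'E.
have k0 : k != 0 by apply: contra a0' => /eqP k0; rewrite a'E k0 scale0r.
have := s'H _ (VK _ (conj Vx ax)); rewrite /hyperplane /= a'E dotZl ax => kc.
have [w [s'w Vw]] := VK _ (conj Vx ax) _ (open_nbhs_nbhs (conj oV Vx)).
have aw : dot a w = c.
  have := s'H _ (subset_closure s'w); rewrite /hyperplane /= a'E dotZl -kc.
  exact: mulfI.
have sw : edge_set s w by rewrite sE; split => //; have [] := VU _ Vw.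
apply: contrapT => ss'; have := edge_disjoint hM ss'.
by move/seteqP => [/(_ w) N _]; exact: N.
Qed.

Lemma neighbourP K s : s \in interior_edges Omega K -> separates s K (neighbour K s).
Proof.
move=> /neighbour_ex[L sKL]; rewrite /neighbour; case: pickP => [L'|/(_ L)]; first by move/asboolP.
by move/asboolP.
Qed.

Lemma separates_interior s K L : separates s K L -> interior_edge Omega s ->
  s \in interior_edges Omega K /\ neighbour K s = L.
Proof.
move=> sKL si; have sK : s \in interior_edges Omega K.
  by apply/interior_edgesP; split => //; exact: (separates_edge_of hM) sKL.
split => //.
exact: (separates_unique hM (separates_sym (neighbourP sK)) (separates_sym sKL)).
Qed.

Lemma neighbour_interior K s : s \in interior_edges Omega K ->
  s \in interior_edges Omega (neighbour K s) /\ neighbour (neighbour K s) s = K.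
Proof.
move=> sK; apply: separates_interior; first exact/separates_sym/neighbourP.
by move/interior_edgesP : sK => [].
Qed.

(** Stated for the ball of the sup norm of row vectors. *)
Lemma convex_ball z (e : R) x y t : ball z e x -> ball z e y -> 0 <= t <= 1 ->
  ball z e (x + t *: (y - x)).
Proof.
move=> [e0 zx] [_ zy] /andP[t0 t1]; split => // k i; rewrite (ord1 k : k = ord0).
have := zx ord0 i; have := zy ord0 i; rewrite /ball /= !mxE => h1 h2.
have -> : z ord0 i - (x ord0 i + t * (y ord0 i - x ord0 i)) =
   (1 - t) * (z ord0 i - x ord0 i) + t * (z ord0 i - y ord0 i) by ring.
apply: le_lt_trans (ler_normD _ _) _; rewrite !normrM (ger0_norm t0) ger0_norm ?subr_ge0//.
have [->|t0'] := eqVneq t 0; first by rewrite mul0r addr0 subr0 mul1r.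
have tp : 0 < t by rewrite lt_def t0'.
have h3 := ltr_pM2l tp (`|z ord0 i - y ord0 i|) e; rewrite h1 in h3.
have t1' : 0 <= 1 - t by rewrite subr_ge0.
have h4 := ler_wpM2l t1' (ltW h2).
by move: h3 => /idP; lra.
Qed.

Hypothesis connO : connected Omega.

(** Let [S] be closed under neighbours. If [S] and its complement were both
    nonempty, the closures of their cells would meet at a point of the
    connected set Omega, and in a small ball around it there would be a cell
    [K] of [S] and a cell [L] outside [S]. Within the ball the two families
    only share sets of null (d-1)-dimensional measure, since a common edge
    would be an interior edge leading out of [S]. But each segment from [K]
    to [L] in a given direction [w] crosses from one family to the other:
    the projection along [w] of the common set would contain a cube. *)
Lemma mesh_connected (S : {set cell M}) : S != finset.set0 ->
  (forall K s, K \in S -> s \in interior_edges Omega K -> neighbour K s \in S) ->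
  S = [set: cell M]%SET.
Proof.
move=> /finset.set0Pn[K0 K0S] nS; apply: contrapT => SN.
have [L0 L0S] : exists L, L \notin S.
  apply: contrapT => H; apply: SN; apply/setP => L; rewrite !inE.
  by apply: contrapT => /negP LS; apply: H; exists L.
pose C (P : pred (cell M)) := \bigcup_(K in [set K | P K]) closure (cell_set K).
have clC P : closed (C P).
  by apply: closed_bigcup => [|K _]; [exact: finite_finset|exact: closed_closure].
pose UU := C (fun K => K \in S); pose VV := C (fun K => K \notin S).
have OUV x : Omega x -> (UU `|` VV) x.
  move=> /(@subset_closure _ Omega); rewrite (cell_cover hM) => -[K _ clK].
  by have [KS|KS] := boolP (K \in S); [left|right]; exists K.
have meet A : connected A -> A `<=` Omega -> A `&` UU !=set0 -> A `&` VV !=set0 ->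
    exists x, [/\ A x, UU x & VV x].
  move=> cA AO.
  exact: (connected_closed_meet cA (clC _) (clC _) (fun x Ax => OUV x (AO x Ax))).
have incl K (P : pred (cell M)) : P K -> forall x, cell_set K x -> C P x.
  by move=> PK x Kx; exists K => //; exact: subset_closure.
have [z [Oz [K KS zK] [L LS zL]]] : exists x, [/\ Omega x, UU x & VV x].
  apply: meet => //.
    exists (centre K0); split; first exact: (cell_sub hM (centre_in hM K0)).
    by apply: (incl K0) => //; exact: (centre_in hM).
  exists (centre L0); split; first exact: (cell_sub hM (centre_in hM L0)).
  by apply: (incl L0) => //; exact: (centre_in hM).
have /nbhs_ballP[e /= e0 eO] : nbhs z Omega by exact: open_nbhs_nbhs.
have oB : open (ball z e) by exact: ball_open.
have zB : nbhs z (ball z e) by exact: nbhsx_ballx.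
have [x0 [Kx0 Bx0]] := zK _ zB; have [y0 [Ly0 By0]] := zL _ zB.
pose w := y0 - x0.
have w0 : w != 0.
  apply/eqP => /eqP; rewrite subr_eq0 => /eqP E.
  have KL : K = L by apply: (cell_eq hM Kx0); rewrite -E.
  by move: LS; rewrite /= -KL KS.
have [i0 wi0] := nonzero_coord w0.
have [l l0 ll] := shadow_lipschitz i0 w.
(* The part of the interface between the two families that lies in the ball. *)
pose N (p : cell M * cell M) := if (p.1 \in S) && (p.2 \notin S) then
  closure (cell_set p.1) `&` closure (cell_set p.2) `&` ball z e else set0.
have null p : leb (shadow i0 w @` N p) = 0%E.
  rewrite /N; case: ifP => [/andP[p1 p2]|_]; last by rewrite image_set0 leb_set0.
  have p12 : p.1 <> p.2 by move=> E; move: p2; rewrite -E p1.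
  have [h0|[s sp]] := cell_interface hM p12.
    apply: (leb_null_sub _ (hausdorff0_image l0 ll h0)).
    by apply: image_subset; exact: subIsetl.
  rewrite (_ : _ `&` _ = set0) ?image_set0 ?leb_set0//.
  have [_ ->] := sp; apply/seteqP; split => // x [clx Bx].
  have [y [sy By]] := clx _ (open_nbhs_nbhs (conj oB Bx)).
  have si : interior_edge Omega s.
    by apply/interior_edgeP; exists y; split => //; exact: eO.
  have [sp1 np] := separates_interior sp si.
  by move: p2; rewrite -np nS.
have open_at x A : open A -> A x -> nbhs x A by move=> oA Ax; exact: open_nbhs_nbhs.
have nx0 : nbhs x0 (cell_set K `&` ball z e).
  by apply: open_at => //; apply: openI => //; exact: (cell_open hM).
have ny0 : nbhs y0 (cell_set L `&` ball z e).
  by apply: open_at => //; apply: openI => //; exact: (cell_open hM).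
have [e1 e10 H1] := near_lift_row i0 nx0.
have [e2 e20 H2] := near_lift_row i0 ny0.
have e12 : 0 < Num.min e1 e2 by rewrite lt_min e10.
apply: (leb_cube_neq0 (v := shadow i0 w x0)
  (A := [set u | exists p, (shadow i0 w @` N p) u]) e12) => [u ue|]; last first.
  exact: (leb_null_cover null).
have [|Kx Bx] := H1 u.
  by move=> j; apply: le_trans (ue j) _; rewrite ge_min lexx.
have [|Ly By] := H2 u.
  by move=> j; apply: le_trans (ue j) _; rewrite ge_min lexx orbT.
set x := x0 + _ in Kx Bx; set y := y0 + _ in Ly By.
have yE : y = x + 1 *: w by rewrite /y /x /w scale1r; apply/rowP => j; rewrite !mxE; ring.
pose g (t : R) := x + t *: w.
have gc : continuous g by exact: continuous_line.
have gB t : 0 <= t <= 1 -> ball z e (g t).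
  move=> t01; rewrite /g (_ : w = y - x); last by rewrite yE scale1r addrC addKr.
  exact: convex_ball.
have clg P : closed (g @^-1` C P).
  by apply: (@closed_comp _ _ g) => // t _; exact: gc.
have [|||t [/= t01 [K1 K1S gK1] [L1 L1S gL1]]] :=
    @connected_closed_meet R (`[0, 1]%classic : set R) _ _ (@segment_connected R 0 1) (clg (fun K => K \in S)) (clg (fun K => K \notin S)).
- by move=> t; rewrite /= in_itv /= => t01; apply: OUV; apply: eO; exact: gB.
- exists 0; split; first by rewrite /= in_itv /= lexx ler01.
  by rewrite /= /g scale0r addr0; exact: (incl K).
- exists 1; split; first by rewrite /= in_itv /= lexx ler01.
  by rewrite /= /g -yE; exact: (incl L).
rewrite in_itv /= in t01.
exists (K1, L1); exists (g t); last by rewrite /g shadow_line// /x shadow_lift_row.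
by rewrite /N /= K1S L1S; split => //; exact: gB.
Qed.

End MeshGraph.

(** * Vector-valued continuity and the integral of an opposite *)

(** The pointwise topology is the initial topology of the evaluations. *)
Lemma continuous_ptws (R : realType) (T : topologicalType) (C : Type)
    (S : T -> {ptws C -> R}) :
  (forall K, continuous (fun x => S x K)) -> continuous S.
Proof.
move=> cS x; apply/cvg_sup => K; move: x.
apply/(@continuousP _ (initial_topology (fun f : C -> R => f K))) => A [B oB <-].
have -> : S @^-1` ((fun f : C -> R => f K) @^-1` B) = (fun x => S x K) @^-1` B by [].
by move/continuousP : (cS K); apply.
Qed.

Lemma continuous_row (R : realType) (T : topologicalType) n (g : T -> 'rV[R]_n) :
  (forall j, continuous (fun x => g x ord0 j)) -> continuous g.
Proof.
move=> cg x A /nbhs_ballP[e /= e0 eA].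
have : \forall y \near x, forall j, ball (g x ord0 j) e (g y ord0 j).
  apply: filter_forall => j; apply: (cg j); exact: nbhsx_ballx.
apply: filterS => y gy; apply: eA; split => // i j.
by rewrite (ord1 i : i = ord0); exact: gy.
Qed.

(** Taking opposites exchanges the positive and negative parts; if one of
    their integrals is infinite, both sides are 0. *)
Lemma Rintegral_oppr d (T : measurableType d) (R : realType)
    (mu : {measure set T -> \bar R}) (D : set T) (f : T -> R) :
  \int[mu]_(x in D) (- f x) = - \int[mu]_(x in D) f x.
Proof.
rewrite /Rintegral.
have -> : (fun x => (- f x)%:E) = (\- (fun x => (f x)%:E))%E.
  by apply/funext => x; rewrite EFinN.
rewrite integralE [X in - fine X]integralE funeposN funenegN.
set a := (\int[mu]_(x in D) _)%E; set b := (\int[mu]_(x in D) _)%E.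
have a0 : (0 <= a)%E by apply: integral_ge0 => x _; exact: funeneg_ge0.
have b0 : (0 <= b)%E by apply: integral_ge0 => x _; exact: funepos_ge0.
move: a b a0 b0 => [a| |] [b| |] //= _ _; rewrite ?oppr0//.
by rewrite opprB.
Qed.

(** * Measures of edges and cells *)

Section MeshMeasure.
Context {R : realType} {m : nat}.
Variables (Omega : set 'rV[R]_m.+1) (M : mesh R m.+1).
Hypothesis openO : open Omega.
Hypothesis bndO : bounded_set Omega.
Hypothesis hM : admissible Omega M.
Implicit Types (K L : cell M) (s : edge M) (a x y z : 'rV[R]_m.+1) (c t : R).

Lemma closure_bound : exists B : R, 0 <= B /\
  forall x, closure Omega x -> forall i, `|x ord0 i| <= B.
Proof.
have [B [_ HB]] := bndO; pose B1 := Num.max (B + 1) 0.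
have BB : B < B1 by rewrite lt_max ltrDl ltr01.
have HO x : Omega x -> forall i, `|x ord0 i| <= B1.
  move=> Ox i; apply: le_trans (HB _ BB _ Ox).
  by rewrite [leRHS]/Num.Def.normr /= mx_normrE; apply: (@le_bigmax _ _ _ 0 (fun ij => `|x ij.1 ij.2|) (ord0, i)).
exists B1; split; first by rewrite le_max lexx orbT.
move=> x clx i; rewrite leNgt; apply/negP => lt.
have e0 : 0 < `|x ord0 i| - B1 by rewrite subr_gt0.
have [y [Oy [_ xy]]] := clx _ (nbhsx_ballx _ _ e0).
have := xy ord0 i; have := HO _ Oy i; rewrite /ball /= => h1 h2.
by have := ler_distD (y ord0 i) (x ord0 i) 0; rewrite !subr0; lra.
Qed.

(** Finiteness matters as much as positivity, as [fine] sends an infinite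
    measure to 0. *)
Lemma measure_edge_gt0 s : (0 < m)%N -> 0 < measure_edge s.
Proof.
move=> m0; have [a [c [U sf]]] := flat_ex hM s; have [a0 oU sE] := sf.
rewrite /measure_edge fine_gt0//= lt_def hausdorff_ge0 andbT; apply/andP; split.
  apply/eqP; apply: (hausdorff_hyperplane_neq0 (c := c) a0 oU); last by rewrite -sE.
  by rewrite -sE; exact: (edge_nonempty hM).
have [B [_ HB]] := closure_bound.
apply: (hausdorff_hyperplane_fin m0 a0 (c := c) (M := B)).
  by rewrite sE; exact: subIsetr.
by move=> x sx; apply: HB; exact: (edge_sub hM sx).
Qed.

Definition cell_measure K : R := fine (leb (cell_set K)).

Lemma leb_bounded (A : set 'rV[R]_m.+1) : A `<=` closure Omega -> (leb A < +oo)%E.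
Proof.
move=> AO; have [B [B0 HB]] := closure_bound.
have : (leb A <= ((2 * (2 * B)) ^+ m.+1)%:E)%E.
  apply: leb_small; first exact: mulr_ge0.
  move=> x y Ax Ay i; apply: le_trans (ler_normB _ _) _.
  by have := HB _ (AO _ Ax) i; have := HB _ (AO _ Ay) i; lra.
by move=> /le_lt_trans; apply; rewrite ltry.
Qed.

Lemma cell_measureE K : leb (cell_set K) = (cell_measure K)%:E.
Proof.
rewrite fineK// ge0_fin_numE ?leb_ge0//; apply: leb_bounded => x Kx.
exact/subset_closure/(cell_sub hM Kx).
Qed.

Lemma cell_measure_gt0 K : 0 < cell_measure K.
Proof.
rewrite -lte_fin -cell_measureE lt_def leb_ge0 andbT; apply/eqP.
have nK : nbhs (centre K) (cell_set K).
  by apply: open_nbhs_nbhs; split; [exact: (cell_open hM)|exact: (centre_in hM)].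
have /nbhs_ballP[e /= e0 eK] := nK.
have e2 : 0 < e / 2 by rewrite divr_gt0.
apply: (leb_cube_neq0 (v := centre K) e2) => u ue; apply: eK; split => // i j.
rewrite (ord1 i : i = ord0) /ball /= mxE opprD addrA subrr add0r normrN.
by apply: le_lt_trans (ue j) _; rewrite ltr_pdivrMr// mulr_natr mulr2n ltrDl.
Qed.

Lemma measurable_cell K : measurable (cell_set K : set (lebesgue_rV_type R m.+1)).
Proof. by apply: measurable_open; exact: (cell_open hM). Qed.

Definition cells (P : pred (cell M)) : set 'rV[R]_m.+1 :=
  \big[setU/set0]_(K <- index_enum (cell M) | P K) cell_set K.

Lemma cellsP P x : cells P x <-> exists2 K, P K & cell_set K x.
Proof.
rewrite /cells -big_filter -bigcup_seq; split => [[K /=]|[K PK Kx]].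
  by rewrite mem_filter => /andP[PK _] Kx; exists K.
by exists K => //=; rewrite mem_filter PK mem_index_enum.
Qed.

Lemma leb_cells P : leb (cells P) = (\sum_(K | P K) cell_measure K)%:E.
Proof.
rewrite /cells -big_filter -[in RHS]big_filter.
have : uniq [seq K <- index_enum (cell M) | P K] by rewrite filter_uniq// index_enum_uniq.
elim: [seq _ <- _ | _] => [_|K s IH /= /andP[Ks us]].
  by rewrite !big_nil; exact: leb_set0.
rewrite !big_cons EFinD -cell_measureE -IH//.
rewrite (@measureU _ _ _ (@leb R m.+1))//.
- exact: measurable_cell.
- apply: (@bigsetU_measurable _ (lebesgue_rV_type R m.+1)) => L _; exact: measurable_cell.
apply/seteqP; split => // x [Kx]; rewrite -bigcup_seq => -[L /= Ls Lx].
by move: Ks; rewrite (cell_eq hM Kx Lx) Ls.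
Qed.

(** Cells are polygonal: their boundaries lie in finitely many hyperplanes. *)
Lemma leb_frontier K : leb (frontier (cell_set K)) = 0%E.
Proof.
have [h [h0 hK]] := cell_polygonal hM K.
pose F i := hyperplane (nth (0, 0) h i).1 (nth (0, 0) h i).2.
apply: (@leb_null_cover R m.+1 'I_(size h) (fun i => F i)) => [i|x /hK[q qh qx]].
  by apply: leb_hyperplane; apply: h0; exact: mem_nth.
have qi : (index q h < size h)%N by rewrite index_mem.
by exists (Ordinal qi); rewrite /F /= nth_index.
Qed.

(** The closures of the cells cover Omega, so what the cells miss lies in
    their boundaries. *)
Lemma leb_skeleton : leb (Omega `\` cells xpredT) = 0%E.
Proof.
apply: (@leb_null_cover R m.+1 (cell M) (fun K => frontier (cell_set K))).
  exact: leb_frontier.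
move=> x [/(@subset_closure _ Omega) + nx]; rewrite (cell_cover hM) => -[K _ clK].
exists K; split => //; rewrite (interior_id _).1; last exact: (cell_open hM).
by move=> Kx; apply: nx; apply/cellsP; exists K.
Qed.

End MeshMeasure.

(** * The scheme as a balance on the graph of the mesh *)

Section MeshScheme.
Context {R : realType} {m : nat}.
Variables (Omega : set 'rV[R]_m.+1) (M : mesh R m.+1).
Hypothesis openO : open Omega.
Hypothesis bndO : bounded_set Omega.
Hypothesis hM : admissible Omega M.
Implicit Types (K L : cell M) (s : edge M) (u : cell M -> R) (t : R).

Lemma integral_cells (f : 'rV[R]_m.+1 -> R) : leb.-integrable Omega (EFin \o f) ->
  \sum_(K : cell M) \int[leb]_(x in cell_set K) f x = \int[leb]_(x in Omega) f x.
Proof.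
move=> fi.
have mO : measurable (Omega : set (lebesgue_rV_type R m.+1)) by exact: measurable_open.
have mK K := measurable_cell hM K.
have sk0 := leb_skeleton hM.
have D : cells (M := M) xpredT `<=` Omega by move=> x /cellsP[K _ Kx]; exact: (cell_sub hM Kx).
have OD : Omega `\` (Omega `\` cells (M := M) xpredT) = cells (M := M) xpredT.
  rewrite setDD setIC; apply/seteqP; split => x; first by case.
  by move=> Cx; split => //; exact: D.
have iK K : leb.-integrable (cell_set K) (EFin \o f).
  by apply: (integrableS mO (mK K) _ fi) => x Kx; exact: (cell_sub hM Kx).
have tr : trivIset [set` index_enum (cell M)] (fun K => cell_set K : set (lebesgue_rV_type R m.+1)).
  by apply/trivIsetP => K L _ _ KL; apply: (cell_disjoint hM); exact/eqP.
rewrite /Rintegral (@negligible_integral _ _ _ leb Omega (Omega `\` cells (M := M) xpredT))//; last first.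
  exact: measurable_leb_null.
rewrite OD /cells integral_bigsetU_EFin//.
- by rewrite sum_fine// => K _; exact: integrable_fin_num.
- exact: index_enum_uniq.
- apply: (measurable_funS mO); last exact: measurable_int fi.
  exact: D.
Qed.

(** A part of Omega that is a union of cells up to boundaries has the
    measure of this union. *)
Lemma leb_mod_skeleton (A : set 'rV[R]_m.+1) (P : pred (cell M)) : A `<=` Omega ->
  cells P `<=` A -> (forall K x, cell_set K x -> A x -> P K) ->
  leb A = (\sum_(K | P K) cell_measure K)%:E.
Proof.
move=> AO PA AP; rewrite -(leb_cells bndO hM); apply/eqP; rewrite eq_le.
apply/andP; split; last exact: le_leb.
have : A `<=` cells P `|` (Omega `\` cells (M := M) xpredT).
  move=> x Ax; have [/cellsP[K _ Kx]|nx] := pselect (cells (M := M) xpredT x).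
    by left; apply/cellsP; exists K => //; exact: AP Kx Ax.
  by right; split => //; exact: AO.
move=> /le_leb /le_trans; apply; apply: le_trans (leb_setU _ _) _.
by rewrite (leb_skeleton hM) adde0.
Qed.

Lemma cell_funE u K x : cell_set K x -> cell_fun u x = u K.
Proof.
move=> Kx; rewrite /cell_fun (bigD1 K)//= indicE mem_set// mulr1.
rewrite big1 ?addr0// => L /eqP LK; rewrite indicE memNset ?mulr0// => Lx.
by apply: LK; exact: (cell_eq hM Lx Kx).
Qed.

Lemma leb_superlevel u t : leb (Omega `&` [set x | t < cell_fun u x]) =
  (\sum_(K | t < u K) cell_measure K)%:E.
Proof.
apply: leb_mod_skeleton; first exact: subIsetl.
  move=> x /cellsP[K tK Kx]; split; first exact: (cell_sub hM Kx).
  by rewrite /= (cell_funE _ Kx).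
by move=> K x Kx [_ /=]; rewrite (cell_funE _ Kx).
Qed.

Lemma leb_domain : leb Omega = (\sum_K cell_measure (M := M) K)%:E.
Proof.
by apply: leb_mod_skeleton => // x /cellsP[K _ Kx]; exact: (cell_sub hM Kx).
Qed.

(** The superlevel sets of [cell_fun u] are unions of cells up to a null
    set, whence the infimum runs over the nonnegative reals. *)
Lemma med_zero u : zero_median (cell_measure (M := M)) u -> med Omega (cell_fun u) = 0.
Proof.
move=> [h0 h1]; rewrite /med; set T := [set t | _].
have TE t : T t <-> 2 * \sum_(K | t < u K) cell_measure K <= \sum_K cell_measure (M := M) K.
  rewrite /T /= leb_superlevel leb_domain -EFinM lee_fin.
  by rewrite ler_pdivlMr// mulrC.
have T0 : T 0 by apply/TE.
have lbT : lbound T 0.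
  move=> t /TE tT; rewrite leNgt; apply/negP => t0.
  move: h1; rewrite ltNge => /negP; apply; apply: le_trans tT.
  rewrite ler_pM2l// big_mkcond [leRHS]big_mkcond /=; apply: ler_sum => K _.
  case: (leP 0 (u K)) => uK; first by rewrite (lt_le_trans t0 uK).
  by case: ifP => // _; apply/ltW/(cell_measure_gt0 bndO hM).
apply/eqP; rewrite eq_le; apply/andP; split.
  by apply: ge_inf => //; exists 0.
by apply: lb_le_inf => //; exists 0.
Qed.

(** The diamond is common to both cells and the normals are opposite. *)
Lemma v_Ksigma_neighbour (v : 'rV[R]_m.+1 -> 'rV[R]_m.+1) K s :
  s \in interior_edges Omega K ->
  v_Ksigma Omega v (neighbour K s) s = - v_Ksigma Omega v K s.
Proof.
move=> sK; have [sL nL] := neighbour_interior openO hM sK.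
have /interior_edgesP[_ si] := sK.
rewrite /v_Ksigma /diamond si nL setUC.
rewrite (normal_opp hM (neighbourP openO hM sK)) -mulrN -Rintegral_oppr; congr (_ * _).
by apply: eq_Rintegral => x _; rewrite dotNr.
Qed.

Lemma d_sigma_neighbour K s : s \in interior_edges Omega K ->
  d_sigma Omega (neighbour K s) s = d_sigma Omega K s.
Proof.
move=> sK; have [sL nL] := neighbour_interior openO hM sK.
have /interior_edgesP[_ si] := sK.
by rewrite /d_sigma si nL -enormN opprB.
Qed.

Lemma d_sigma_gt0 K s : s \in interior_edges Omega K -> 0 < d_sigma Omega K s.
Proof.
move=> sK; have /interior_edgesP[_ si] := sK.
rewrite /d_sigma si; apply: enorm_gt0; apply/eqP => /eqP; rewrite subr_eq0 => /eqP E.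
have [KL _] := neighbourP openO hM sK; apply: KL.
by apply: (cell_eq hM (centre_in hM K)); rewrite E; exact: (centre_in hM).
Qed.

(** The rate at which [K] loses mass through [s]: diffusion plus the
    outgoing part of the upwind convection. What [K] receives through [s] is
    lost by the neighbour, for which the sign of the velocity is reversed. *)
Definition outflow (v : 'rV[R]_m.+1 -> 'rV[R]_m.+1) (lam : edge M -> R) K s : R :=
  measure_edge s / d_sigma Omega K s * lam s +
  measure_edge s * Num.max 0 (v_Ksigma Omega v K s).

Lemma scheme_balance v f lam u :
  scheme Omega v f lam u <->
  forall K, balance (@interior_edges _ _ Omega M) (@neighbour _ _ M) (outflow v lam) u K =
    \int[leb]_(x in cell_set K) f x.
Proof.
suff E K : balance (@interior_edges _ _ Omega M) (@neighbour _ _ M) (outflow v lam) u K =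
    \sum_(s in interior_edges Omega K)
      measure_edge s / d_sigma Omega K s * lam s * (u K - u (neighbour K s)) +
    \sum_(s in interior_edges Omega K)
      measure_edge s * v_Ksigma Omega v K s * upwind u (v_Ksigma Omega v K s) K s.
  by split => H K; have := H K; rewrite E.
rewrite -big_split /=; apply: eq_bigr => s sK.
rewrite /outflow d_sigma_neighbour// v_Ksigma_neighbour// /upwind.
set w := v_Ksigma _ _ _ _; case: (leP 0 w) => w0.
  by rewrite (max_l (_ : - w <= 0)) ?oppr_le0//; ring.
by rewrite (max_r (_ : 0 <= - w)) ?oppr_ge0 ?ltW//; ring.
Qed.

Lemma interior_edge_ex s : interior_edge Omega s -> exists K, s \in interior_edges Omega K.
Proof.
move=> si; have [K [U [_ sE]]] := edge_open hM s; exists K.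
by apply/interior_edgesP; split => //; rewrite /edge_of sE; exact: subIsetr.
Qed.

(** Without cells Omega is empty and every level is allowed; the infimum of
    all reals is 0 by convention. *)
Lemma med_no_cell (g : 'rV[R]_m.+1 -> R) : (cell M -> False) -> med Omega g = 0.
Proof.
move=> noK; have O0 : Omega = set0.
  apply/seteqP; split => // x /(@subset_closure _ Omega).
  by rewrite (cell_cover hM) => -[K _ _]; exact: noK K.
rewrite /med inf_out// => -[_ [b]]; rewrite O0 => lb.
have := lb (b - 1); rewrite /= set0I leb_set0 mul0e lexx => /(_ isT).
by rewrite lerBrDr gerDl ler10.
Qed.

End MeshScheme.

(** * Existence of a solution *)

Theorem theorem3p1 (R : realType) (d : nat) (hd : (2 <= d)%N)
    (Omega : set 'rV[R]_d)
    (hOmega_open : open Omega) (hOmega_bounded : bounded_set Omega)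
    (hOmega_connected : connected Omega) (hOmega_polygonal : polygonal Omega)
    (p : R) (hp2 : d = 2%N -> 2 < p) (hp3 : (3 <= d)%N -> p = d%:R)
    (v : 'rV[R]_d -> 'rV[R]_d)
    (hv : forall i : 'I_d, (fun x => v x ord0 i) \_ Omega \in Lfun leb p%:E)
    (lambda : R -> R) (lambda_oo mu : R)
    (hlambda_cont : continuous lambda)
    (hlambda : forall r, mu <= lambda r <= lambda_oo) (hmu : 0 < mu)
    (f : 'rV[R]_d -> R)
    (hf : leb.-integrable Omega (EFin \o f))
    (hf0 : \int[leb]_(x in Omega) f x = 0)
    (M : mesh R d) (hM : admissible Omega M)
    (hreg : exists2 xi : R, 0 < xi &
       forall (K : cell M) (s : edge M), s \in edges K ->
         xi * d_sigma Omega K s <= edist_set (centre K) (edge_set s))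
    (lam : {ptws cell M -> R} -> edge M -> R)
    (hlam_cont : forall s : edge M, continuous (fun u => lam u s))
    (hlam : forall (u : {ptws cell M -> R}) (K L : cell M) (s : edge M),
       interior_edge Omega s -> separates s K L ->
       Num.min (lambda (u K)) (lambda (u L)) <= lam u s
         <= Num.max (lambda (u K)) (lambda (u L))) :
  exists u : {ptws cell M -> R},
    med Omega (cell_fun u) = 0 /\ scheme Omega v f (lam u) u.
Proof.
case: d hd Omega hOmega_open hOmega_bounded hOmega_connected hOmega_polygonal hp2 hp3 v hv f hf hf0 M hM
  hreg lam hlam_cont hlam => [//|[//|m]] _ Omega openO bndO connO _ _ _ v _ f fi f0 M hM _ lam lamc lamP.
case: (pickP (fun _ : cell M => true)) => [K0 _|noK]; last first.
  have noK' (K : cell M) : False by have := noK K.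
  by exists (fun=> 0); split => [|K]; [exact: (med_no_cell hM)|case: (noK' K)].
(* The cut-off at mu makes the frozen coefficients positive for every c, so that
   the solution map is defined and continuous on the whole space. *)
pose coef (c : 'rV[R]_#|edge M|) s := Num.max mu (c ord0 (enum_rank s)).
have coef_gt0 c s : 0 < coef c s by rewrite lt_max hmu.
have coefc s : continuous (fun c => coef c s).
  move=> c; apply: (@continuous_max R _ (fun=> mu : R^o)
      (fun c : 'rV[R]_#|edge M| => c ord0 (enum_rank s) : R^o) c).
    exact: cst_continuous.
  exact: coord_continuous.
have [S [Sc Smed Sbal]] : exists S : 'rV[R]_#|edge M| -> cell M -> R,
    [/\ forall K, continuous (fun c => S c K),
    forall c, zero_median (cell_measure (M := M)) (S c) &
    forall c K, balance (@interior_edges _ _ Omega M) (@neighbour _ _ M)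
      (outflow Omega v (coef c)) (S c) K = \int[leb]_(x in cell_set K) f x].
  apply: (balance_solution K0).
  - by move=> K s sK; have [] := neighbour_interior openO hM sK.
  - by move=> K s sK; have [] := neighbour_interior openO hM sK.
  - exact: mesh_connected.
  - move=> c K s sK; apply: ltr_pwDl.
      apply: mulr_gt0 => //; apply: divr_gt0; last exact: (d_sigma_gt0 openO hM).
      exact: (measure_edge_gt0 bndO hM).
    apply: mulr_ge0; last by rewrite le_max lexx.
    exact/ltW/(measure_edge_gt0 bndO hM).
  - move=> K s; apply: continuous_add; last exact: continuous_cst.
    by apply: continuous_mul => //; exact: continuous_cst.
  - exact: (cell_measure_gt0 bndO hM).
  - by rewrite (integral_cells openO hM).
(* The values of lam lie in the cube on the interior edges; on the others the
   constant mu does. *)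
pose g (c : 'rV[R]_#|edge M|) : 'rV[R]_#|edge M| := \row_j
  (if interior_edge Omega (enum_val j) then lam (S c) (enum_val j) else mu).
have gc : continuous g.
  apply: continuous_row => j.
  have -> : (fun c => g c ord0 j) = (fun c =>
      if interior_edge Omega (enum_val j) then lam (S c) (enum_val j) else mu).
    by apply/funext => c; rewrite mxE.
  case: (interior_edge Omega (enum_val j)); last exact: continuous_cst.
  move=> c; apply: (@continuous_comp _ _ _ (S : _ -> {ptws cell M -> R}) (fun u => lam u (enum_val j))).
    exact: continuous_ptws.
  exact: lamc.
have gb c j : mu <= g c ord0 j <= lambda_oo.
  rewrite mxE; case: ifPn => [si|_]; last first.
    by rewrite lexx; have /andP[/le_trans h /h] := hlambda 0.
  have [K sK] := interior_edge_ex hM si.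
  have := lamP (S c) _ _ _ si (neighbourP openO hM sK).
  set r := lambda _; set r' := lambda _.
  have /andP[r1 r2] : mu <= r <= lambda_oo by exact: hlambda.
  have /andP[r1' r2'] : mu <= r' <= lambda_oo by exact: hlambda.
  move=> /andP[h1 h2]; apply/andP; split.
    by apply: le_trans h1; rewrite le_min r1.
  by apply: (le_trans h2); rewrite ge_max r2.
have [c gcE] := brouwer gc gb.
exists (S c); split; first exact: (med_zero bndO hM).
have coefE s : interior_edge Omega s -> coef c s = lam (S c) s.
  move=> si; have := gb c (enum_rank s).
  have : g c ord0 (enum_rank s) = lam (S c) s by rewrite mxE enum_rankK si.
  by rewrite gcE /coef => -> /andP[h _]; rewrite (max_r h).
apply/(scheme_balance openO hM) => K; rewrite -(Sbal c).
apply: eq_bigr => s sK; have /interior_edgesP[_ si] := sK.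
by rewrite /outflow coefE.
Qed.
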